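(* Let $R$ be a countable Prüfer domain. Given a countable coreduced flat $R$-module $C$, the following assertions are equivalent: (1) $C$ has plain $R$-projective length at most one; (2) $C$ has plain projective length at most one; (3) $C$ has finite rank.
   Context: For a module $C$, let $\Phi C$ be the union of the images of the idempotent endomorphisms of $C$ whose image is a finitely generated projective module (a direct summand of $C$). $C$ is coreduced if $\Phi C=0$, i.e. $C$ has no nonzero finitely generated projective direct summand. The rank of a flat module $M$ is $\dim_K(K\otimes M)$, $K$ the fraction field of $R$. A Polish module is an $R$-module that is a Polish abelian group on which each $r\in R$ acts continuously. A module with a Polish cover is $G=\hat G/N$ with $\hat G$ a Polish module and $N$ a Polishable submodule (image of a continuous injective homomorphism from a Polish module); the complexity of a submodule $\hat H/N$ in $G$ is that of $\hat H$ in $\hat G$. $s_0(G)$ is the closure of $\{0\}$ in $G$. $G$ has plain Solecki length at most $1$ if $\{0\}$ is $\boldsymbol\Sigma^0_2$ in $s_0(G)$ (i.e. $N$ is $\boldsymbol\Sigma^0_2$ in its closure in $\hat G$). For countable flat $C,A$ and $0\to S\to P\to C\to0$ exact with $P,S$ countable projective, $\mathrm{Ext}(C,A)=\mathrm{Hom}(S,A)/\mathrm{Ran}(\mathrm{Hom}(P,A)\to\mathrm{Hom}(S,A))$ as a module with a Polish cover, with pointwise convergence topology on $\mathrm{Hom}(S,A)$; here $s_0(\mathrm{Ext}(C,A))=\mathrm{Ext}(C,A)$. $C$ has plain $A$-projective length at most one if $\mathrm{Ext}(C,A)$ has plain Solecki length at most $1$; it has plain projective length at most one if this holds for every countable flat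 module $A$. *)

(* Defs.v *)
From HB Require Import structures.
From mathcomp Require Import all_boot all_order all_algebra.
From mathcomp Require Import all_classical.
From mathcomp Require Import topology borel_hierarchy.

Set Implicit Arguments.
Unset Strict Implicit.
Unset Printing Implicit Defensive.

Import GRing.Theory.
Local Open Scope classical_set_scope.
Local Open Scope ring_scope.
Local Open Scope quotient_scope.

(** [tensor phi A M] is [A (x)_R M] for an [R]-module [M] and an [S]-module [A]
viewed as an [R]-module along [phi : R -> S]; it is an [S]-module.  The case
[phi = idfun] is the tensor product of [R]-modules, the case
[A = S^o] is extension of scalars.

A formal sum of pairs is a sequence, and [tensor_eq] is the congruence
generated by the relations of the tensor product.  Signs and coefficients are
absorbed in the first component of the pairs. *)

Section Tensor.
Context {R S : comNzRingType} (phi : {rmorphism R -> S}).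
Context (A : lmodType S) (M : lmodType R).
Implicit Types (s t u : seq (A * M)) (a : A) (m : M).

Inductive tensor_eq : seq (A * M) -> seq (A * M) -> Prop :=
| tensor_eq_refl s : tensor_eq s s
| tensor_eq_sym s t : tensor_eq s t -> tensor_eq t s
| tensor_eq_trans s t u : tensor_eq s t -> tensor_eq t u -> tensor_eq s u
| tensor_eq_cat s s' t t' :
    tensor_eq s s' -> tensor_eq t t' -> tensor_eq (s ++ t) (s' ++ t')
| tensor_eq_catC s t : tensor_eq (s ++ t) (t ++ s)
| tensor_eq0 m : tensor_eq [:: (0, m)] [::]
| tensor_eqDl a b m : tensor_eq [:: (a + b, m)] [:: (a, m); (b, m)]
| tensor_eqDr a m n : tensor_eq [:: (a, m + n)] [:: (a, m); (a, n)]
| tensor_eqZ r a m : tensor_eq [:: (phi r *: a, m)] [:: (a, r *: m)].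

Definition tensor_rel : rel (seq (A * M)) := fun s t => `[< tensor_eq s t >].

Lemma tensor_rel_equiv : equiv_class_of tensor_rel.
Proof.
split.
- by move=> s; apply/asboolP; exact: tensor_eq_refl.
- by move=> s t; apply/asboolP/asboolP; exact: tensor_eq_sym.
- move=> t s u /asboolP st /asboolP tu; apply/asboolP.
  exact: tensor_eq_trans st tu.
Qed.

Canonical tensor_equiv := EquivRelPack tensor_rel_equiv.

Definition tensor := {eq_quot tensor_equiv}.

HB.instance Definition _ := Choice.on tensor.
HB.instance Definition _ := EqQuotient.on tensor.

Lemma tensorP s t : reflect (tensor_eq s t) (\pi_tensor s == \pi_tensor t).
Proof. by rewrite piE; exact: asboolP. Qed.

Lemma tensor_repr s : tensor_eq (repr (\pi_tensor s)) s.
Proof. by apply/tensorP; rewrite reprK. Qed.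

Lemma tensor_eq_map (f : A -> A) :
  f 0 = 0 -> {morph f : a b / a + b} -> (forall c, {morph f : a / c *: a}) ->
  forall s t, tensor_eq s t ->
    tensor_eq [seq (f p.1, p.2) | p <- s] [seq (f p.1, p.2) | p <- t].
Proof.
move=> f0 fD fZ s t; elim=> {s t} [s|s t _ h|s t u _ h1 _ h2|s s' t t' _ h1 _ h2
  |s t|m|a b m|a m n|r a m] /=.
- exact: tensor_eq_refl.
- exact: tensor_eq_sym.
- exact: tensor_eq_trans h1 h2.
- by rewrite !map_cat; exact: tensor_eq_cat.
- by rewrite !map_cat; exact: tensor_eq_catC.
- by rewrite f0; exact: tensor_eq0.
- by rewrite fD; exact: tensor_eqDl.
- exact: tensor_eqDr.
- by rewrite fZ; exact: tensor_eqZ.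
Qed.

Lemma tensorW (P : tensor -> Prop) :
  (forall s, P (\pi_tensor s)) -> forall x, P x.
Proof. by move=> Ppi x; rewrite -[x]reprK; exact: Ppi. Qed.

Definition tensor_add (x y : tensor) : tensor := \pi_tensor (repr x ++ repr y).
Definition tensor_scale (c : S) (x : tensor) : tensor :=
  \pi_tensor [seq (c *: p.1, p.2) | p <- repr x].

Lemma tensor_addE s t :
  tensor_add (\pi_tensor s) (\pi_tensor t) = \pi_tensor (s ++ t).
Proof.
by apply/eqP/tensorP; apply: tensor_eq_cat; exact: tensor_repr.
Qed.

Lemma tensor_scaleE c s :
  tensor_scale c (\pi_tensor s) = \pi_tensor [seq (c *: p.1, p.2) | p <- s].
Proof.
apply/eqP/tensorP; apply: (@tensor_eq_map (fun a => c *: a)).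
- exact: scaler0.
- by move=> a b; rewrite scalerDr.
- by move=> d a; rewrite !scalerA mulrC.
- exact: tensor_repr.
Qed.

Lemma tensor_addA : associative tensor_add.
Proof. by elim/tensorW => s; elim/tensorW => t; elim/tensorW => u;
  rewrite !tensor_addE catA. Qed.

Lemma tensor_addC : commutative tensor_add.
Proof.
elim/tensorW => s; elim/tensorW => t; rewrite !tensor_addE.
by apply/eqP/tensorP; exact: tensor_eq_catC.
Qed.

Lemma tensor_add0 : left_id (\pi_tensor [::]) tensor_add.
Proof. by elim/tensorW => s; rewrite tensor_addE. Qed.

Lemma tensor_addN :
  left_inverse (\pi_tensor [::]) (tensor_scale (-1)) tensor_add.
Proof.
elim/tensorW => s; rewrite tensor_scaleE tensor_addE; apply/eqP/tensorP.
elim: s => [|[a m] s IHs] /=; first exact: tensor_eq_refl.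
set s' := map _ s in IHs *.
apply: (@tensor_eq_trans _ ([:: (-1 *: a, m); (a, m)] ++ (s' ++ s))).
  rewrite -cat1s -[(a, m) :: s]cat1s -[in X in tensor_eq _ X]cat1s -!catA.
  apply: tensor_eq_cat; first exact: tensor_eq_refl.
  rewrite !catA; apply: tensor_eq_cat; last exact: tensor_eq_refl.
  exact: tensor_eq_catC.
rewrite -[[::]]cats0; apply: tensor_eq_cat; last exact: IHs.
apply: tensor_eq_trans; first by apply: tensor_eq_sym; exact: tensor_eqDl.
by rewrite scaleN1r addNr; exact: tensor_eq0.
Qed.

HB.instance Definition _ := GRing.isZmodule.Build tensor
  tensor_addA tensor_addC tensor_add0 tensor_addN.

Lemma tensor_scaleA (c d : S) x :
  tensor_scale c (tensor_scale d x) = tensor_scale (c * d) x.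
Proof.
elim/tensorW: x => s; rewrite !tensor_scaleE -map_comp.
by congr (\pi_tensor _); apply: eq_map => p /=; rewrite scalerA.
Qed.

Lemma tensor_scale1 : left_id 1 tensor_scale.
Proof.
elim/tensorW => s; rewrite tensor_scaleE; congr (\pi_tensor _).
by rewrite -[RHS]map_id; apply: eq_map => -[a m] /=; rewrite scale1r.
Qed.

Lemma tensor_scaleDr : right_distributive tensor_scale +%R.
Proof.
move=> c; elim/tensorW => s; elim/tensorW => t.
by rewrite [_ + _]tensor_addE !tensor_scaleE [RHS]tensor_addE map_cat.
Qed.

Lemma tensor_scaleDl x : {morph tensor_scale^~ x : a b / a + b}.
Proof.
move=> c d; elim/tensorW: x => s; rewrite !tensor_scaleE [RHS]tensor_addE.
apply/eqP/tensorP; elim: s => [|[a m] s IHs] /=; first exact: tensor_eq_refl.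
rewrite scalerDl.
set s1 := map _ s in IHs *; set s2 := map _ s in IHs *.
set s3 := map _ s in IHs *.
apply: (@tensor_eq_trans _ ([:: (c *: a, m); (d *: a, m)] ++ (s2 ++ s3))).
  by rewrite -cat1s; apply: tensor_eq_cat IHs; exact: tensor_eqDl.
rewrite -[(d *: a, m) :: s3]cat1s -[in X in tensor_eq _ X]cat1s.
rewrite -[in X in tensor_eq X _]cat1s -!catA.
apply: tensor_eq_cat; first exact: tensor_eq_refl.
rewrite !catA; apply: tensor_eq_cat; last exact: tensor_eq_refl.
exact: tensor_eq_catC.
Qed.

HB.instance Definition _ := GRing.Zmodule_isLmodule.Build S tensor
  tensor_scaleA tensor_scale1 tensor_scaleDr tensor_scaleDl.

Definition tens a m : tensor := \pi_tensor [:: (a, m)].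

Lemma tensDl a b m : tens (a + b) m = tens a m + tens b m.
Proof. by rewrite [RHS]tensor_addE; apply/eqP/tensorP; exact: tensor_eqDl. Qed.

Lemma tensDr a m n : tens a (m + n) = tens a m + tens a n.
Proof. by rewrite [RHS]tensor_addE; apply/eqP/tensorP; exact: tensor_eqDr. Qed.

Lemma tensZl c a m : tens (c *: a) m = c *: tens a m.
Proof. by rewrite [RHS]tensor_scaleE. Qed.

Lemma tensZr r a m : tens a (r *: m) = phi r *: tens a m.
Proof.
rewrite -tensZl; apply/eqP; rewrite eq_sym.
by apply/tensorP; exact: tensor_eqZ.
Qed.

Lemma tensor_piE s : \pi_tensor s = \sum_(p <- s) tens p.1 p.2.
Proof.
elim: s => [|p s IHs]; first by rewrite big_nil.
by rewrite big_cons -IHs [RHS]tensor_addE; case: p.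
Qed.

End Tensor.

Section TensorMap.
Context {R S : comNzRingType} (phi : {rmorphism R -> S}).
Context (A B : lmodType S) (M : lmodType R) (f : {linear A -> B}).

Definition tensor_map (x : tensor phi A M) : tensor phi B M :=
  \sum_(p <- repr x) tens phi (f p.1) p.2.

Lemma tensor_map_pi s :
  tensor_map (\pi_(tensor phi A M) s) = \sum_(p <- s) tens phi (f p.1) p.2.
Proof.
rewrite /tensor_map.
have sumE (u v : seq (A * M)) : tensor_eq phi u v ->
    \sum_(p <- u) tens phi (f p.1) p.2 = \sum_(p <- v) tens phi (f p.1) p.2.
  elim=> {u v} //.
  - by move=> s1 t1 u1 _ -> _ ->.
  - by move=> s1 s1' t1 t1' _ h1 _ h2; rewrite !big_cat h1 h2.
  - by move=> s1 t1; rewrite !big_cat /= addrC.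
  - move=> m; rewrite big_seq1 big_nil /= -[in LHS](scale0r 0).
    by rewrite linearZ tensZl scale0r.
  - by move=> a b m; rewrite !big_cons !big_nil !addr0 linearD tensDl.
  - by move=> a m n; rewrite !big_cons !big_nil !addr0 tensDr.
  - by move=> r a m; rewrite !big_seq1 /= linearZ tensZl tensZr.
by apply: sumE; exact: tensor_repr.
Qed.

Lemma tensor_map_tens a m : tensor_map (tens phi a m) = tens phi (f a) m.
Proof. by rewrite tensor_map_pi big_seq1. Qed.

End TensorMap.

Definition flat {R : comNzRingType} (M : lmodType R) : Prop :=
  forall (A B : lmodType R) (f : {linear A -> B}),
    injective f -> injective (@tensor_map R R idfun A B M f).

Definition projective {R : comNzRingType} (P : lmodType R) : Prop :=
  forall (X Y : lmodType R) (g : {linear X -> Y}) (f : {linear P -> Y}),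
    range g = setT -> exists h : {linear P -> X}, g \o h =1 f.

Definition fg_module {R : comNzRingType} (M : lmodType R) : Prop :=
  exists (n : nat) (b : 'I_n -> M),
    forall v, exists c : 'I_n -> R, v = \sum_i c i *: b i.

Section LinearRange.
Context {R : comNzRingType} (A B : lmodType R) (f : {linear A -> B}).

Definition lrange_pred : {pred B} := fun y => `[< range f y >].

Lemma lrange_submod_closed : submod_closed lrange_pred.
Proof.
split; first by apply/asboolP; exists 0; rewrite ?linear0.
move=> c _ _ /asboolP[x _ <-] /asboolP[y _ <-]; apply/asboolP.
by exists (c *: x + y); rewrite ?linearP.
Qed.

HB.instance Definition _ :=
  GRing.isSubmodClosed.Build R B lrange_pred lrange_submod_closed.

Record lrange := LRange { lrange_val : B; _ : lrange_val \in lrange_pred }.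

HB.instance Definition _ := [isSub for lrange_val].
HB.instance Definition _ := [Choice of lrange by <:].
HB.instance Definition _ := [SubChoice_isSubLmodule of lrange by <:].

End LinearRange.

Definition Phi {R : comNzRingType} (C : lmodType R) : set C :=
  [set x | exists e : {linear C -> C},
    [/\ e \o e =1 e, fg_module (lrange e), projective (lrange e)
      & range e x]].

Arguments Phi {R} C _.

Definition coreduced {R : comNzRingType} (C : lmodType R) : Prop :=
  Phi C = [set 0].

Definition has_rank {R : idomainType} (M : lmodType R) (n : nat) : Prop :=
  let K := {fraction R} in
  exists b : 'I_n -> tensor (@tofrac R : {rmorphism R -> K}) K^o M,
    forall v, exists! c : 'rV[K]_n, v = \sum_i c 0 i *: b i.

Definition finite_rank {R : idomainType} (M : lmodType R) : Prop :=
  exists n, has_rank M n.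

(** Ideals are seen as fractional ideals, i.e. as [R]-submodules of [K], and [I]
is invertible when [I J = R] for some fractional ideal [J]. *)

Section Prufer.
Context (R : idomainType).
Let K := {fraction R}.
Implicit Types I J : set K.

Definition submod_frac J : Prop :=
  [/\ J 0, (forall x y, J x -> J y -> J (x + y))
    & forall (r : R) x, J x -> J (tofrac r * x)].

Definition ideal_span (s : seq R) : set K :=
  [set tofrac (\sum_(i < size s) c i * s`_i) | c in [set: nat -> R]].

Definition prod_frac I J : set K :=
  [set \sum_(p <- t) p.1 * p.2
    | t in [set t : seq (K * K) | forall p, p \in t -> I p.1 /\ J p.2]].

Definition invertible_frac I : Prop :=
  exists2 J, submod_frac J & prod_frac I J = range (@tofrac R).

Definition prufer_domain : Prop :=
  forall s : seq R, (exists2 x, x \in s & x != 0) ->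
    invertible_frac (ideal_span s).

End Prufer.

(** For a module with a Polish cover [G / N], [{0}] has the complexity in
[s_0(G / N) = closure N / N] that [N] has in [closure N] with the subspace
topology, so that the notion only involves the topology of [G] and the
subset [N]. *)

Definition solecki0 {G : topologicalType} (N : set G) : set G := closure N.

Definition plain_solecki_length_le1 {G : topologicalType} (N : set G) : Prop :=
  Fsigma (set_val @^-1` N : set (solecki0 N)).

(** [homSpace S A] carries the topology of pointwise convergence, [A] being
discrete; it is kept apart from [{linear S -> A}], which has no topology. *)

Definition ptws_of_linear {R : comNzRingType} (S A : lmodType R)
  (f : {linear S -> A}) : {ptws S -> discrete_topology A} := f.

Definition homSpace {R : comNzRingType} (S A : lmodType R) : Type :=
  {linear S -> A}.

HB.instance Definition _ (R : comNzRingType) (S A : lmodType R) :=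
  gen_eqMixin (homSpace S A).
HB.instance Definition _ (R : comNzRingType) (S A : lmodType R) :=
  gen_choiceMixin (homSpace S A).
HB.instance Definition _ (R : comNzRingType) (S A : lmodType R) :=
  Topological.copy (homSpace S A)
    (initial_topology (@ptws_of_linear R S A : homSpace S A -> _)).

Record countable_projective_resolution {R : comNzRingType} (C : lmodType R) :=
  CountableProjectiveResolution {
    res_S : lmodType R;
    res_P : lmodType R;
    res_i : {linear res_S -> res_P};
    res_p : {linear res_P -> C};
    res_S_countable : countable [set: res_S];
    res_P_countable : countable [set: res_P];
    res_S_projective : projective res_S;
    res_P_projective : projective res_P;
    res_i_inj : injective res_i;
    res_exact : range res_i = res_p @^-1` [set 0];
    res_p_surj : range res_p = setT
  }.

Section Ext.
Context {R : comNzRingType} (C A : lmodType R).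

Definition ext_restr (r : countable_projective_resolution C)
  (g : homSpace (res_P r) A) : homSpace (res_S r) A :=
  (g : {linear _ -> _}) \o res_i r : {linear _ -> _}.

(** [Ext(C, A)] is [homSpace S A] modulo [ext_null r A]. *)
Definition ext_null (r : countable_projective_resolution C) :
  set (homSpace (res_S r) A) := range (@ext_restr r).

(** Up to isomorphism, [Ext(C, A)] does not depend on the resolution, so that
quantifying over all of them is the same as fixing one. *)
Definition plain_projective_length_rel_le1 : Prop :=
  forall r : countable_projective_resolution C,
    plain_solecki_length_le1 (@ext_null r).

End Ext.

Definition plain_projective_length_le1 {R : comNzRingType} (C : lmodType R) :
    Prop :=
  forall A : lmodType R, countable [set: A] -> flat A ->
    plain_projective_length_rel_le1 C A.

(* Main.v *)
Require Import Defs.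
From HB Require Import structures.
From mathcomp Require Import all_boot all_order all_algebra.
From mathcomp Require Import all_classical.
From mathcomp Require Import topology borel_hierarchy.
From mathcomp Require Import ring.
Import GRing.Theory.

(** If [c_1, ..., c_n] span [C] up to torsion, then a homomorphism [P -> A] is
determined by its restriction to [S] and its values at lifts of the [c_j].
Prescribing these values cuts out a closed set of [f : S -> A] that extend, and
there are countably many choices, so that the range of [Hom(P, A)] is Fsigma.

Conversely, write [C] as the union of finitely generated submodules [X_n].  They
are projective because [R] is Prüfer, and the telescope [S = P = (+)_n X_n] of
this filtration resolves [C], so that [Ext(C, R)] is [lim^1] of the tower
[Hom(X_n, R)].  If the range is Fsigma, a Baire category argument gives [m] such
that every class coming from the subtower of the homomorphisms vanishing on
[X_m] dies.  As all groups involved are countable, a diagonal argument shows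
that this subtower satisfies the Mittag-Leffler condition.  Hence the dual basis
of [X_n] modulo [X_m] extends to [C], which makes the quotient of the
purifications of [X_k] and [X_m] a finitely generated projective direct summand
of [C] for every [k >= m].  As [C] is coreduced, [C] is the purification of
[X_m]. *)

Set Implicit Arguments.
Unset Strict Implicit.
Unset Printing Implicit Defensive.

Local Open Scope classical_set_scope.
Local Open Scope ring_scope.

(** * Denominators in the fraction field *)

Section Fractions.
Variable R : idomainType.
Local Notation K := {fraction R}.

Lemma fractionP (k : K) : exists r a : R, r != 0 /\ tofrac r * k = tofrac a.
Proof.
elim/quotW: k => x; exists \d_x, \n_x; split; first exact: denom_ratioP.
have x2 : \d_x != 0 by exact: denom_ratioP.
apply/eqP; rewrite !piE /= equivfE /mulf.
by rewrite !numden_Ratio ?mulf_neq0 ?oner_eq0 // mulr1 mul1r mulrC.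
Qed.

Lemma common_denominator (s : seq K) :
  exists2 r : R, r != 0 & forall k, k \in s -> exists a,
    tofrac r * k = tofrac a.
Proof.
elim: s => [|k s [r r0 IH]]; first by exists 1; rewrite ?oner_neq0.
have [q [a [q0 qk]]] := fractionP k.
exists (q * r) => [|l]; first by rewrite mulf_neq0.
rewrite inE => /orP[/eqP ->|/IH[b rl]].
  by exists (r * a); rewrite !tofracM -qk; ring.
by exists (q * b); rewrite !tofracM -rl; ring.
Qed.

End Fractions.

(** * Submodules, spans and purifications *)

Section Submodules.
Variable R : idomainType.
Variables C A : lmodType R.
Implicit Types (X Y : set C) (x y z : C) (s : nat -> C).

Definition submodule_set X :=
  X 0 /\ forall (r : R) x y, X x -> X y -> X (r *: x + y).

(** Equivalently, the quotient by the submodule [X] is torsion free. *)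
Definition pure_submodule X :=
  submodule_set X /\ forall (r : R) x, r != 0 -> X (r *: x) -> X x.

(** Homomorphisms defined on a submodule are encoded as functions on all of [C], with arbitrary
    values outside [X]; this avoids a separate module type for each submodule. *)
Definition linear_on X (f : C -> A) :=
  forall (r : R) x y, X x -> X y -> f (r *: x + y) = r *: f x + f y.

Definition lspan n s : set C :=
  [set x | exists a : nat -> R, x = \sum_(i < n) a i *: s i].

Section SubmoduleSet.
Variables (X : set C) (Xs : submodule_set X).

Lemma submodule0 : X 0. Proof. exact: Xs.1. Qed.

Lemma submoduleZ (r : R) x : X x -> X (r *: x).
Proof.
by move=> Xx; rewrite -[_ *: _]addr0; apply: Xs.2 => //; exact: Xs.1.
Qed.

Lemma submoduleD x y : X x -> X y -> X (x + y).
Proof. by move=> Xx Xy; rewrite -[x]scale1r; exact: Xs.2. Qed.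

Lemma submoduleB x y : X x -> X y -> X (x - y).
Proof. by move=> Xx Xy; rewrite addrC -scaleN1r; exact: Xs.2. Qed.

Lemma submodule_sum (I : Type) (t : seq I) (P : pred I) (F : I -> C) :
  (forall i, P i -> X (F i)) -> X (\sum_(i <- t | P i) F i).
Proof.
by move=> XF; apply: big_ind => //; [exact: submodule0|exact: submoduleD].
Qed.

Section LinearOn.
Variables (f : C -> A) (fl : linear_on X f).

Lemma linear_on0 : f 0 = 0.
Proof.
have := fl 1 submodule0 submodule0.
by rewrite scaler0 addr0 scale1r => /eqP;
  rewrite -subr_eq0 opprD addNKr oppr_eq0 => /eqP.
Qed.

Lemma linear_onD x y : X x -> X y -> f (x + y) = f x + f y.
Proof. by move=> Xx Xy; have := fl 1 Xx Xy; rewrite !scale1r. Qed.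

Lemma linear_onZ (r : R) x : X x -> f (r *: x) = r *: f x.
Proof.
by move=> Xx; have := fl r Xx submodule0; rewrite linear_on0 !addr0.
Qed.

Lemma linear_on_sum (I : Type) (t : seq I) (P : pred I) (F : I -> C) :
  (forall i, P i -> X (F i)) ->
  f (\sum_(i <- t | P i) F i) = \sum_(i <- t | P i) f (F i).
Proof.
move=> XF; elim: t => [|i t IH]; first by rewrite !big_nil linear_on0.
rewrite !big_cons; case: ifP => // Pi; rewrite linear_onD ?IH //;
  first exact: XF.
exact: submodule_sum.
Qed.

End LinearOn.
End SubmoduleSet.

Lemma lspan_submodule n s : submodule_set (lspan n s).
Proof.
split; first by exists (fun=> 0); rewrite big1 // => i _; rewrite scale0r.
move=> r _ _ [a ->] [b ->]; exists (fun i => r * a i + b i).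
rewrite scaler_sumr -big_split; apply: eq_bigr => i _ /=.
by rewrite scalerA scalerDl.
Qed.

Lemma mem_lspan n s i : (i < n)%N -> lspan n s (s i).
Proof.
move=> ltin; exists (fun j => (j == i)%:R).
rewrite (bigD1 (Ordinal ltin)) //= eqxx scale1r big1 ?addr0 // => j.
by rewrite -val_eqE /= => /negPf ->; rewrite scale0r.
Qed.

Lemma lspan_sub n s X : submodule_set X ->
  (forall i, (i < n)%N -> X (s i)) -> lspan n s `<=` X.
Proof.
move=> Xs Xsi _ [a ->]; apply: (submodule_sum Xs) => i _.
by apply: submoduleZ => //; exact: Xsi.
Qed.

Lemma lspan_le m n s : (m <= n)%N -> lspan m s `<=` lspan n s.
Proof.
move=> le_mn; apply: lspan_sub; first exact: lspan_submodule.
by move=> i lt_im; apply: mem_lspan; exact: leq_trans le_mn.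
Qed.

Definition purification X : set C :=
  [set x | exists2 r : R, r != 0 & X (r *: x)].

Lemma purification_pure X : submodule_set X -> pure_submodule (purification X).
Proof.
move=> Xs; split; [split|].
- by exists 1; rewrite ?oner_neq0 // scaler0; exact: submodule0.
- move=> r x y [a a0 Xax] [b b0 Xby]; exists (a * b);
  first by rewrite mulf_neq0.
  have -> : (a * b) *: (r *: x + y) = (b * r) *: (a *: x) + a *: (b *: y).
    by rewrite scalerDr !scalerA; congr (_ *: _ + _); ring.
  by apply: submoduleD => //; exact: submoduleZ.
- move=> r x r0 [a a0 X_]; exists (a * r); first by rewrite mulf_neq0.
  by rewrite -scalerA.
Qed.

Lemma sub_purification X : X `<=` purification X.
Proof. by move=> x Xx; exists 1; rewrite ?oner_neq0 ?scale1r. Qed.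

End Submodules.

Arguments lspan {R C} n s _.
Arguments purification {R C} X _.

(** * Dual bases over a Prüfer domain *)

Section DualBasis.
Variables (R : idomainType) (C : lmodType R).
Local Notation K := {fraction R}.
Implicit Types (X Y : set C) (x y z : C) (s : nat -> C).

(* [l] is the coordinate along [x0] of the rank one module [Y1 / Y]. *)
Lemma rank_one_coordinate Y x0 : pure_submodule Y -> ~ Y x0 ->
  exists (Y1 : set C) (l : C -> K),
    [/\ pure_submodule Y1, Y `<=` Y1, Y1 x0, l x0 = 1
      & (forall (r : R) x y, Y1 x -> Y1 y ->
          l (r *: x + y) = tofrac r * l x + l y)
        /\ (forall x, Y1 x -> (l x = 0 <-> Y x))].
Proof.
move=> [Ys Yp] Yx0.
pose Y1 : set C := [set z | exists r a : R, r != 0 /\ Y (r *: z - a *: x0)].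
have /choice[l lP] : forall z, exists k : K, forall r a : R,
    r != 0 -> Y (r *: z - a *: x0) -> tofrac r * k = tofrac a.
  move=> z.
  have [[q [b [q0 Yq]]]|nY1] := pselect (Y1 z); last first.
    by exists 0 => r a r0 Yr; case: nY1; exists r, a.
  have q0' : tofrac q != 0 by rewrite tofrac_eq0.
  exists ((tofrac q)^-1 * tofrac b) => r a r0 Yr.
  (* Two presentations of [z] agree: purity and [~ Y x0] force the coefficient of [x0] in their
     combination to be 0. *)
  have Yd : Y ((a * q - r * b) *: x0).
    have -> : (a * q - r * b) *: x0
        = r *: (q *: z - b *: x0) - q *: (r *: z - a *: x0).
      rewrite !scalerBr !scalerA scalerBl [q * r]mulrC [q * a]mulrC opprB.
      by rewrite [RHS]addrC addrA subrK.
    by apply: submoduleB => //; exact: submoduleZ.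
  have [/eqP|d0] := eqVneq (a * q - r * b) 0; last by case: Yx0;
    exact: Yp d0 Yd.
  rewrite subr_eq0 => /eqP aq; rewrite mulrCA -tofracM -aq tofracM.
  by rewrite mulrCA mulVf ?mulr1.
have lE z (r a : R) : r != 0 -> Y (r *: z - a *: x0) ->
    l z = tofrac a / tofrac r.
  by move=> r0 /(lP _ _ _ r0) <-; rewrite mulrC mulKf // tofrac_eq0.
have x0E z : z = 1 *: z - 0 *: x0 by rewrite scale1r scale0r subr0.
exists Y1, l; split.
- split=> [|q z q0 [r [a [r0 Yr]]]]; last first.
    by exists (r * q), a; rewrite mulf_neq0 // -scalerA.
  split; first by exists 1, 0; rewrite oner_neq0 -x0E; split=> //; exact: Ys.1.
  move=> c x y [r [a [r0 Yr]]] [q [b [q0 Yq]]].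
  exists (r * q), (q * c * a + r * b); rewrite mulf_neq0 //; split=> //.
  have -> : (r * q) *: (c *: x + y) - (q * c * a + r * b) *: x0
      = (q * c) *: (r *: x - a *: x0) + r *: (q *: y - b *: x0).
    rewrite !scalerBr !scalerDr !scalerA scalerDl opprD addrACA.
    by congr (_ *: _ - _ + _); ring.
  by apply: submoduleD => //; exact: submoduleZ.
- by move=> z Yz; exists 1, 0; rewrite oner_neq0 -x0E.
- by exists 1, 1; rewrite oner_neq0 subrr; split=> //; exact: Ys.1.
- by rewrite (lE _ 1 1) ?oner_neq0 ?subrr ?divr1 ?tofrac1 ?invr1 ?mulr1 //;
  exact: Ys.1.
- split=> [c x y [r [a [r0 Yr]]] [q [b [q0 Yq]]]|x [r [a [r0 Yr]]]].
    have rq0 : r * q != 0 by rewrite mulf_neq0.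
    apply: (@mulfI _ (tofrac (r * q))); first by rewrite tofrac_eq0.
    rewrite (lP _ (r * q) (q * c * a + r * b)) //.
      rewrite tofracD !tofracM -(lP _ _ _ r0 Yr) -(lP _ _ _ q0 Yq) mulrDr.
      by congr (_ + _); rewrite !mulrA // -[_ * _ * tofrac c]mulrA [tofrac r *
        _]mulrC.
    have -> : (r * q) *: (c *: x + y) - (q * c * a + r * b) *: x0
        = (q * c) *: (r *: x - a *: x0) + r *: (q *: y - b *: x0).
      rewrite !scalerBr !scalerDr !scalerA scalerDl opprD addrACA.
      by congr (_ *: _ - _ + _); ring.
    by apply: submoduleD => //; exact: submoduleZ.
  split=> [lx0|Yx]; last first.
    by rewrite (lE _ 1 0) ?oner_neq0 ?tofrac0 ?mul0r // -x0E.
  have := lP _ _ _ r0 Yr; rewrite lx0 mulr0 => /esym/eqP.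
  rewrite tofrac_eq0 => /eqP a0; move: Yr; rewrite a0 scale0r subr0.
  exact: Yp.
Qed.

(** The image of [X] in the quotient by [Y] is a finitely generated projective module, the dual
    basis being lifted to [X]. *)
Definition has_dual_basis X Y :=
  exists m (f : 'I_m -> C -> R^o) (v : 'I_m -> C),
  [/\ forall i, linear_on X (f i),
      forall i x, X x -> Y x -> f i x = 0,
      forall i, X (v i)
    & forall x, X x -> Y (x - \sum_i f i x *: v i)].

(* The step of the induction splits off [X / (X `&` Y1)], with [Y1 / Y] of rank
   one; there remains [(X `&` Y1) / Y], which is isomorphic to an invertible
   ideal. *)
Lemma dual_basis n s Y : prufer_domain R -> pure_submodule Y ->
  has_dual_basis (lspan n s) Y.
Proof.
move=> R_prufer; set X := lspan n s.
have Xs : submodule_set X by exact: lspan_submodule.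
(* The induction is on the number of generators outside [Y]; passing to [Y1], which contains [s i0],
   lowers it. *)
have [k] := ubnP #|[pred i : 'I_n | ~~ `[< Y (s i) >]]|.
elim: k Y => // k IH Y; rewrite ltnS => leYk Yp.
have [YX|] := pselect (forall i : 'I_n, Y (s i)).
  exists 0%N, (fun _ _ => 0), (fun=> 0); split=> [[]//|[]//|[]//|x].
  rewrite big_ord0 subr0; apply: lspan_sub; first exact: Yp.1.
  by move=> i lin; exact: (YX (Ordinal lin)).
move=> /existsNP[i0 Yi0].
have [Y1 [l [Y1p YY1 Y1i0 li0 [lD lY]]]] := rank_one_coordinate Yp Yi0.
have Y1s := Y1p.1.
have {IH} [m [f [v [fl f0 Xv fv]]]] : has_dual_basis X Y1.
  apply: IH Y1p; apply: leq_trans leYk; apply: proper_card.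
  apply/properP; split.
    apply/fintype.subsetP => i; rewrite !inE; apply: contra => /asboolP Yi.
    by apply/asboolP; exact: YY1.
  by exists i0; rewrite !inE; [apply/asboolP|apply/negPn/asboolP].
(* [p] retracts [X] onto its intersection with [Y1]. *)
pose p x := x - \sum_i f i x *: v i.
have pl : linear_on X p.
  move=> r x y Xx Xy; rewrite /p scalerBr addrACA -opprD; congr (_ - _).
  rewrite scaler_sumr -big_split; apply: eq_bigr => i _ /=.
  by rewrite (fl i) // scalerDl scalerA.
have Xp x : X x -> X (p x).
  move=> Xx; apply: submoduleB => //; apply: submodule_sum => // i _.
  exact: submoduleZ.
have pid x : X x -> Y1 x -> p x = x.
  by move=> Xx Y1x; rewrite /p big1 ?subr0 // => i _; rewrite f0 ?scale0r.
have Xs_ i : (i < n)%N -> X (s i) by move=> ?; exact: mem_lspan.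
have l0 : l 0 = 0 by apply/lY; [exact: Y1s.1|exact: Yp.1.1].
have lsum (a : nat -> R) : l (\sum_(i < n) a i *: p (s i))
    = \sum_(i < n) tofrac (a i) * l (p (s i)).
  have : Y1 (\sum_(i < n) a i *: p (s i)) /\ l (\sum_(i < n) a i *: p (s i))
    = \sum_(i < n) tofrac (a i) * l (p (s i)); last by case.
  apply: (big_rec2 (fun x k => Y1 x /\ l x = k)) => [|i x k' _ [Y1x <-]].
    by split=> //; exact: Y1s.1.
  have Y1i : Y1 (p (s i)) by apply: fv; exact: Xs_.
  by split; [exact: Y1s.2|exact: lD].
have pspan x : X x -> Y1 x -> exists a : nat -> R,
  x = \sum_(i < n) a i *: p (s i).
  move=> Xx Y1x; have [a xE] := Xx; exists a.
  rewrite -(pid _ Xx Y1x) {1}xE (linear_on_sum Xs pl) => [|i _].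
    by apply: eq_bigr => i _; rewrite (linear_onZ Xs pl) //; exact: Xs_.
  by apply: submoduleZ => //; exact: Xs_.
(* The [l (p (s i))] generate the image of this intersection under [l]; multiplying by [r0] turns it
   into an ideal of [R], generated by the [S i]. *)
have [r0 r0n0 r0P] := common_denominator [seq l (p (s i)) | i : 'I_n].
have /choice[S SP] : forall i, exists a : R, (i < n)%N ->
    tofrac r0 * l (p (s i)) = tofrac a.
  move=> i.
  have [lin|] := boolP (i < n)%N; last by exists 0.
  have /r0P[a aP] : l (p (s i)) \in [seq l (p (s i)) | i : 'I_n].
    by apply/mapP; exists (Ordinal lin); rewrite ?mem_enum.
  by exists a.
have idealE (c : nat -> R) :
  tofrac (\sum_(i < size (mkseq S n)) c i * (mkseq S n)`_i)
    = tofrac r0 * l (\sum_(i < n) c i *: p (s i)).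
  rewrite size_mkseq lsum mulr_sumr rmorph_sum; apply: eq_bigr => i _.
  by rewrite nth_mkseq // rmorphM /= mulrCA SP.
have [J Js IJ] : invertible_frac (ideal_span (mkseq S n)).
  apply: R_prufer; exists (S i0); first by apply: map_f;
    rewrite mem_iota leq0n add0n ltn_ord.
  by rewrite -tofrac_eq0 -SP // pid ?li0 ?mulr1 ?tofrac_eq0 //; exact: Xs_.
(* Here 1 is a sum of products of elements [r0 * l (w j)] of the ideal and elements [q j] of its
   inverse. Hence [q j * r0 * l] has values in [R] on the intersection, and these functionals form
   with the [w j] a dual basis of the rank one part. *)
have [t tP t1] : prod_frac (ideal_span (mkseq S n)) J 1.
  by rewrite IJ; exists 1 => //; rewrite tofrac1.
pose q (j : 'I_(size t)) := (tnth (in_tuple t) j).2.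
have tj (j : 'I_(size t)) := tP _ (mem_tnth j (in_tuple t)).
have /choice[w wP] : forall j : 'I_(size t), exists w, [/\ X w, Y1 w
    & (tnth (in_tuple t) j).1 = tofrac r0 * l w].
  move=> j.
  have [[c _ <-] _] := tj j; exists (\sum_(i < n) c i *: p (s i)); split.
  - by apply: submodule_sum => // i _; apply: submoduleZ => //; apply: Xp;
    exact: Xs_.
  - by apply: submodule_sum => // i _; apply: submoduleZ => //; apply: fv;
    exact: Xs_.
  - exact: idealE.
have [g gP] : exists g : 'I_(size t) -> C -> R, forall j x, X x -> Y1 x ->
    tofrac (g j x) = q j * (tofrac r0 * l x).
  suff gP : forall jx : 'I_(size t) * C, exists a : R, X jx.2 -> Y1 jx.2 ->
      tofrac a = q jx.1 * (tofrac r0 * l jx.2).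
    have [g gP'] := choice gP; exists (fun j x => g (j, x)) => j x.
    exact: (gP' (j, x)).
  move=> [j x] /=; have [[Xx Y1x]|nX] := pselect (X x /\ Y1 x); last first.
    by exists 0 => *; case: nX.
  have [a xE] := pspan _ Xx Y1x.
  have : prod_frac (ideal_span (mkseq S n)) J (q j * (tofrac r0 * l x)).
    exists [:: (tofrac r0 * l x, q j)]; last by rewrite big_seq1 mulrC.
    move=> _ /[!inE] /eqP -> /=; split; last exact: (tj j).2.
    by exists a => //; rewrite idealE -xE.
  by rewrite IJ => -[b _ bE]; exists b.
have gl j : linear_on X (fun x => g j (p x) : R^o).
  move=> r x y Xx Xy; change (g j (p (r *: x + y)) = r * g j (p x) + g j (p y)).
  have [Xpx Xpy Ypx Ypy] : [/\ X (p x), X (p y), Y1 (p x) & Y1 (p y)].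
    by split; [exact: Xp|exact: Xp|exact: fv|exact: fv].
  apply/eqP; rewrite -tofrac_eq tofracD tofracM pl //.
  rewrite !gP //; [|exact: Xs.2|exact: Y1s.2].
  by rewrite lD // !mulrDr; apply/eqP; congr (_ + _); rewrite !mulrA;
    congr (_ * _);
     rewrite mulrC !mulrA.
exists (m + size t)%N.
exists (fun i x => match fintype.split i with inl i => f i x | inr j =>
  g j (p x) end).
exists (fun i => match fintype.split i with inl i => v i | inr j => w j end).
split=> [i|i x Xx Yx|i|x Xx].
- by case: (fintype.split i) => j; [exact: fl|exact: gl].
- case: (fintype.split i) => j; first by apply: f0 => //; exact: YY1.
  apply/eqP; suff: tofrac (g j (p x)) == 0 by rewrite tofrac_eq0.
  rewrite gP; [|exact: Xp|exact: fv].
  rewrite pid //; last exact: YY1.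
  by have -> : l x = 0 by [apply/lY => //; exact: YY1]; rewrite !mulr0.
- by case: (fintype.split i) => j //; have [] := wP j.
- rewrite big_split_ord /= opprD addrA.
  under eq_bigr do rewrite (unsplitK (inl _)).
  under [X in _ - X]eq_bigr do rewrite (unsplitK (inr _)).
  rewrite -/(p x).
  have Y1x : Y1 (p x) := fv _ Xx.
  have Yw : Y1 (\sum_i g i (p x) *: w i).
    by apply: submodule_sum => // j _; apply: submoduleZ => //; have [] := wP j.
  apply/lY; first exact: submoduleB.
  have -> : l (p x - \sum_i g i (p x) *: w i)
      = l (p x) - l (\sum_i g i (p x) *: w i).
    by rewrite addrC -scaleN1r lD // rmorphN1 mulN1r addrC.
  suff -> : l (\sum_i g i (p x) *: w i) = l (p x) by rewrite subrr.
  have -> : l (\sum_i g i (p x) *: w i) = \sum_i tofrac (g i (p x)) * l (w i).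
    have : Y1 (\sum_i g i (p x) *: w i) /\
      l (\sum_i g i (p x) *: w i) = \sum_i tofrac (g i (p x)) * l (w i);
        last by case.
    apply: (big_rec2 (fun x k => Y1 x /\ l x = k)) => [|i z k' _ [Y1z <-]].
      by split=> //; exact: Y1s.1.
    have [_ Y1w _] := wP i.
    by split; [exact: Y1s.2|exact: lD].
  rewrite -[RHS]mul1r -t1 (big_tnth _ _ t) mulr_suml; apply: eq_bigr => j _ /=.
  have [_ _ ->] := wP j; rewrite gP //; last exact: Xp.
  by rewrite -/(q j); ring.
Qed.

End DualBasis.

(** * Pointwise convergence on spaces of homomorphisms *)

Section LinearMaps.
Variables (R : comNzRingType) (S A : lmodType R).

Lemma linear_eqP (f g : {linear S -> A}) : f =1 g -> f = g.
Proof.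
case: f g => [f [[fa] [fs]]] [g [[ga] [gs]]] /= /funext fg;
  case: _ / fg in ga gs *.
by rewrite (Prop_irrelevance fa ga) (Prop_irrelevance fs gs).
Qed.

Lemma linear_of_fun (f : S -> A) : linear f -> exists g : {linear S -> A},
  g =1 f.
Proof.
move=> fl; pose fL := GRing.isLinear.Build _ _ _ _ f fl.
by exists (HB.pack f fL : {linear S -> A}).
Qed.

Lemma homSpace_nbhs (f : homSpace S A) (U : set (homSpace S A)) : nbhs f U <->
  exists E : seq S, [set g : homSpace S A |
    {in E, (f : {linear _ -> _}) =1 (g : {linear _ -> _})}] `<=` U.
Proof.
split=> [|[E EU]].
  rewrite nbhsE => -[V [[W oW <-] Wf] VU].
  pose agree (E : seq S) :=
    [set g : {ptws S -> discrete_topology A} | {in E, f =1 g}].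
  have FF : Filter (filter_from setT agree).
    apply: filter_from_filter; first by exists [::].
    move=> E1 E2 _ _; exists (E1 ++ E2) => // g gE.
    by split=> x xE; apply: gE; rewrite mem_cat xE ?orbT.
  (* The sets [agree E] generate a filter converging to [f] in each coordinate, so every open set
     around [f] contains one of them. *)
  have : filter_from setT agree
      --> (ptws_of_linear f : {ptws S -> discrete_topology A}).
    apply/cvg_sup => x U1 [V1 [[W1 _ <-]] W1f WU1].
    exists [:: x] => // g /(_ x); rewrite inE eqxx => /(_ isT) fg.
    by apply: WU1; change (W1 (g x)); rewrite -fg; exact: W1f.
  move=> /(_ W) [|E _ EW]; first by apply: open_nbhs_nbhs.
  by exists E => g gE; apply: VU; exact: EW.
apply: (filterS EU); elim: E {EU} => [|x E IH]; first exact: filterS filterT.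
have xP : nbhs f
    [set g : homSpace S A | ptws_of_linear g x = ptws_of_linear f x].
  have fx : nbhs (proj x (ptws_of_linear f)) [set ptws_of_linear f x].
    exact: discrete_set1.
  have := @proj_continuous S (fun=> discrete_topology A) x
    (ptws_of_linear f) _ fx.
  exact: (@initial_continuous (homSpace S A) _ (@ptws_of_linear R S A) f).
apply: filterS (filterI xP IH) => g [gf fgE] y.
rewrite inE => /orP[/eqP ->|]; [exact: esym gf|exact: fgE].
Qed.

Lemma closed_homSpaceP (F : set (homSpace S A)) : closed F <->
  forall f : {linear S -> A},
    (forall E : seq S, exists g : {linear S -> A}, F g /\ {in E,
      f =1 g}) -> F f.
Proof.
split=> [Fcl f fF|FP f fF].
  apply: Fcl => U /homSpace_nbhs[E EU]; have [g [Fg fg]] := fF E.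
  by exists g; split=> //; exact: EU.
apply: FP => E; have [g [Fg fg]]
  := fF _ (proj2 (homSpace_nbhs _ _) (ex_intro _ E (@subset_refl _ _))).
by exists g.
Qed.
End LinearMaps.

(** * Flat modules *)

Section Flatness.

(** The universal property of the tensor product, on the level of formal sums. *)
Lemma tensor_eq_eval (R : comNzRingType) (A M : lmodType R) (B : lmodType R)
    (h : A -> M -> B) :
  (forall a b m, h (a + b) m = h a m + h b m) ->
  (forall a m n, h a (m + n) = h a m + h a n) ->
  (forall r a m, h (r *: a) m = r *: h a m) ->
  (forall r a m, h a (r *: m) = r *: h a m) ->
  forall s t, @tensor_eq R R idfun A M s t ->
    \sum_(p <- s) h p.1 p.2 = \sum_(p <- t) h p.1 p.2.
Proof.
move=> hDl hDr hZl hZr s t; elim=> {s t} //.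
- by move=> s t u _ -> _ ->.
- by move=> s s' t t' _ hs _ ht; rewrite !big_cat /= hs ht.
- by move=> s t; rewrite !big_cat /= addrC.
- by move=> m; rewrite big_seq1 big_nil -(scale0r (0 : A)) hZl scale0r.
- by move=> a b m; rewrite !big_cons !big_nil !addr0 hDl.
- by move=> a m n; rewrite !big_cons !big_nil !addr0 hDr.
- by move=> r a m; rewrite !big_seq1 hZl hZr.
Qed.

(** Multiplication by [r] is injective on [R], hence remains so after tensoring with [M]; it sends
    [1 (x) x] to [1 (x) (r *: x)], which is 0. *)
Lemma flat_torsion_free (R : idomainType) (M : lmodType R) :
  flat M -> forall (r : R) x, r != 0 -> r *: x = 0 -> x = 0 :> M.
Proof.
move=> Mflat r x r0 rx0.
have [f fE] : exists f : {linear R^o -> R^o}, f =1 (fun a => r * a : R^o).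
  by apply: linear_of_fun => c a b /=; rewrite mulrDr mulrCA.
have fI : injective f by move=> a b; rewrite !fE => /(mulfI r0).
have tens0 : tens idfun (1 : R^o) (0 : M) = tens idfun (0 : R^o) x.
  by rewrite -[0 in LHS](scale0r x) tensZr /= -tensZl scale0r.
have : tens idfun (1 : R^o) x = tens idfun (0 : R^o) x.
  apply: (Mflat _ _ f fI); rewrite !tensor_map_tens !fE mulr0 mulr1.
  have -> : r = r *: 1 :> R^o by rewrite /GRing.scale /= mulr1.
  by rewrite tensZl -[r]/(idfun r) -tensZr /= rx0 tens0.
move=> /eqP/tensorP/(@tensor_eq_eval R R^o M M (fun a m => (a : R) *: m)).
rewrite !big_seq1 /= scale1r scale0r; apply => *.
- exact: scalerDl.
- exact: scalerDr.
- by rewrite scalerA.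
- by rewrite !scalerA mulrC.
Qed.

(** Every tensor over [R^o] has the form [a (x) 1] for a unique [a], so that [tensor_map f] amounts
    to [f]. *)
Lemma flat_regular (R : comNzRingType) : flat (R^o : lmodType R).
Proof.
move=> A B f fI.
have tensE (D : lmodType R) (s : seq (D * R^o)) :
    \sum_(p <- s) tens idfun p.1 p.2
      = tens idfun (\sum_(p <- s) (p.2 : R) *: p.1) (1 : R^o).
  elim: s => [|[a m] s IH]; last first.
    rewrite !big_cons IH /= tensDl; congr (_ + _).
    have {1}-> : m = (m : R) *: (1 : R^o) by rewrite /GRing.scale /= mulr1.
    by rewrite tensZr tensZl.
  by rewrite !big_nil -[0 in RHS](scale0r 0) tensZl scale0r.
have tens1I (D : lmodType R) (a b : D) :
    tens idfun a (1 : R^o) = tens idfun b (1 : R^o) -> a = b.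
  move=> /eqP/tensorP/(@tensor_eq_eval R D R^o D (fun a m => (m : R) *: a)).
  rewrite !big_seq1 /= !scale1r; apply => *.
  - exact: scalerDr.
  - exact: scalerDl.
  - by rewrite !scalerA mulrC.
  - by rewrite scalerA.
move=> x y; elim/(@tensorW R R idfun A R^o): x => s;
  elim/(@tensorW R R idfun A R^o): y => t.
rewrite !tensor_piE !tensE !tensor_map_tens => /tens1I/fI.
by move=> ->.
Qed.

End Flatness.

(** * Finite rank and spanning up to torsion *)

Section Rank.
Variables (R : idomainType) (C : lmodType R).
Local Notation K := {fraction R}.
Local Notation tof := (@tofrac R : {rmorphism R -> K}).

Section Torsion.
Variables (Y : set C) (Yp : pure_submodule Y).

(** The numerator of [k] over the denominator [r], with default 0 when [r] does not clear [k]. *)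
Let num (r : R) (k : K) : R := xget 0 [set a | tofrac r * k = tofrac a].

Let clears (r : R) (s : seq (K^o * C)) :=
  forall p, p \in s -> exists a, tofrac r * p.1 = tofrac a.

Let cleared (r : R) (s : seq (K^o * C)) : C := \sum_(p <- s) num r p.1 *: p.2.

Let numE r k a : tofrac r * k = tofrac a -> num r k = a.
Proof.
rewrite /num => ka; case: xgetP => [b _ /= kb|/(_ a)/(_ ka)//].
by apply/eqP; rewrite -tofrac_eq -kb ka.
Qed.

Let clearedM q r s : clears r s ->
  clears (q * r) s /\ cleared (q * r) s = q *: cleared r s.
Proof.
move=> rs; have qrs p : p \in s ->
    tofrac (q * r) * p.1 = tofrac (q * num r p.1).
  by move=> /rs[a ap]; rewrite (numE ap) !tofracM -ap mulrA.
split=> [p /qrs|]; first by exists (q * num r p.1).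
rewrite /cleared scaler_sumr; apply: eq_big_seq => p /qrs /numE ->.
by rewrite scalerA.
Qed.

Let clears_catP r s t : clears r (s ++ t) -> clears r s /\ clears r t.
Proof. by move=> rst; split=> p ps; apply: rst; rewrite mem_cat ps ?orbT. Qed.

Let cleared_cat r s t : cleared r (s ++ t) = cleared r s + cleared r t.
Proof. exact: big_cat. Qed.

(** [cleared r s] represents in [C] the multiple by [r] of the tensor of [s]; modulo a pure
    submodule it depends on this tensor only. *)
Lemma tensor_eq_cleared s t : tensor_eq tof s t -> forall r, r != 0 ->
  clears r s -> clears r t -> Y (cleared r s - cleared r t).
Proof.
have [Ys Ypure] := Yp; have Y0 := Ys.1.
elim=> {s t}.
- by move=> s r *; rewrite subrr.
- by move=> s t _ IH r r0 rs rt; rewrite -opprB -sub0r; apply: submoduleB => //;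
  exact: IH.
- move=> s t u _ IHst _ IHtu r r0 rs ru.
  (* The middle sum [t] need not be cleared by [r]: pass to [q * r] with [q] clearing [t], then
     cancel [q] by purity. *)
  have [q q0 qt] := common_denominator [seq p.1 | p <- t].
  have {}qt : clears q t by move=> p pt; apply: qt; exact: map_f.
  apply: (Ypure q) => //; rewrite scalerBr.
  have [qrs <-] := clearedM q rs; have [qru <-] := clearedM q ru.
  have [rqt _] := clearedM r qt; rewrite mulrC in rqt.
  rewrite -[X in Y (X - _)](subrK (cleared (q * r) t)) -addrA.
  by apply: submoduleD => //; [apply: IHst|apply: IHtu]; rewrite ?mulf_neq0.
- move=> s s' t t' _ IHs _ IHt r r0 /clears_catP[rs rt] /clears_catP[rs' rt'].
  rewrite !cleared_cat opprD addrACA.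
  by apply: submoduleD => //; [exact: IHs|exact: IHt].
- by move=> s t r r0 _ _; rewrite !cleared_cat [cleared r t + _]addrC subrr.
- move=> m r r0 _ _; rewrite /cleared big_seq1 big_nil (@numE _ _ 0).
    by rewrite scale0r subrr.
  by rewrite mulr0 tofrac0.
- move=> a b m r r0 _ rs.
  have [c ca] := rs (a, m) (mem_head _ _).
  have [d db] : exists d, tofrac r * b = tofrac d.
    by apply: (rs (b, m)); rewrite !inE eqxx orbT.
  rewrite /cleared !big_cons !big_nil !addr0 /= (numE ca) (numE db) (@numE _ _
    (c + d)).
    by rewrite scalerDl subrr.
  by rewrite mulrDr ca db tofracD.
- by move=> a m n r *; rewrite /cleared !big_cons !big_nil !addr0 scalerDr
  subrr.
- move=> c a m r r0 _ rs; have [b ba] := rs (a, c *: m) (mem_head _ _).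
  rewrite /cleared !big_seq1 /= (numE ba) (@numE _ _ (c * b)).
    by rewrite scalerA mulrC subrr.
  by rewrite mulrCA ba tofracM.
Qed.

(* [C / Y] embeds in [K (x) (C / Y)], for [Y] pure. *)
Lemma tens1_pure (x : C) (s : seq (K^o * C)) :
  tens tof 1 x = \sum_(p <- s) tens tof p.1 p.2 ->
  (forall p, p \in s -> Y p.2) -> Y x.
Proof.
have [Ys Ypure] := Yp.
rewrite -tensor_piE => /eqP/tensorP xs sY.
have [r r0 rP] := common_denominator [seq p.1 | p <- s].
have rs : clears r s by move=> p ps; apply: rP; exact: map_f.
have rE : tofrac r * 1 = tofrac r by rewrite mulr1.
have /(_ _)/(_ rs) := tensor_eq_cleared xs r0.
have rx : clears r [:: (1, x)] by move=> p /[!inE] /eqP ->; exists r.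
move=> /(_ rx); rewrite {1}/cleared big_seq1 (numE rE) => Yrx.
apply: (Ypure r) => //; rewrite -[r *: x](subrK (cleared r s)).
apply: submoduleD => //; rewrite /cleared big_seq;
  apply: submodule_sum => // p ps.
by apply: submoduleZ => //; exact: sY.
Qed.

End Torsion.

(** The second components of the formal sums representing a basis span [C] up to torsion, by
    [tens1_pure] for the purification of their span. *)
Lemma finite_rank_span : finite_rank C ->
  exists n (c : nat -> C), purification (lspan n c) = setT.
Proof.
move=> [n [b bP]].
pose cs := flatten [seq [seq p.2 | p <- repr (b i)] | i <- enum 'I_n].
exists (size cs), (nth 0 cs); apply/seteqP; split=> // x _.
have [Ys Yp] := purification_pure (lspan_submodule (size cs) (nth 0 cs)).
have [k [kE _]] := bP (tens tof 1 x).
apply: (@tens1_pure _ (conj Ys Yp) x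
  (flatten [seq [seq (k 0 i *: p.1, p.2) | p <- repr (b i)] | i <- enum 'I_n])).
  rewrite kE big_flatten big_map big_enum /=; apply: eq_bigr => i _;
    rewrite big_map.
  rewrite -[b i in LHS]reprK tensor_piE scaler_sumr.
  by apply: eq_bigr => p _; rewrite tensZl.
move=> p /flattenP[_ /mapP[i _ ->] /mapP[q qb ->]] /=.
have : q.2 \in cs.
  apply/flattenP; exists [seq p.2 | p <- repr (b i)]; last exact: map_f.
  by apply/mapP; exists i; rewrite ?mem_enum.
move=> qcs; apply: sub_purification; rewrite -(nth_index 0 qcs).
by apply: mem_lspan; rewrite index_mem.
Qed.

End Rank.

(** In a spanning family of least size, a nontrivial relation would express one vector by the
    others, which would then still span. *)
Lemma minimal_spanning_unique (K : fieldType) (V : lmodType K) n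
    (b : 'I_n -> V) :
  (forall v, exists c : 'I_n -> K, v = \sum_i c i *: b i) ->
  exists m (b : 'I_m -> V), forall v, exists! c : 'rV[K]_m,
    v = \sum_i c 0 i *: b i.
Proof.
pose spans m := exists b : 'I_m -> V, forall v, exists c : 'I_m -> K,
  v = \sum_i c i *: b i.
move=> bP; have : exists m, `[< spans m >] by exists n; apply/asboolP; exists b.
move=> /ex_minnP[m /asboolP[{bP}b bP] mmin]; exists m, b => v.
case: m => [|m] in b bP mmin *.
  have [c ->] := bP v; exists 0; split=> [|c' _]; first by rewrite !big_ord0.
  by apply/rowP => -[].
have [c vE] := bP v; exists (\row_i c i); split.
  by rewrite vE; apply: eq_bigr => i _; rewrite mxE.
move=> c' vE'; apply/rowP => i0; rewrite mxE.
apply/eqP; rewrite -subr_eq0; apply/negPn/negP => d0.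
pose d i := c i - c' 0 i; have db : \sum_i d i *: b i = 0.
  by under eq_bigr do rewrite scalerBl; rewrite sumrB -vE -vE' subrr.
suff /mmin : `[< spans m >] by rewrite ltnn.
apply/asboolP; exists (fun j => b (lift i0 j)) => w.
have [e ->] := bP w; exists (fun j =>
  e (lift i0 j) - e i0 / d i0 * d (lift i0 j)).
rewrite (bigD1_ord i0) //=; move: db; rewrite (bigD1_ord i0) //= => /eqP.
rewrite addr_eq0 => /eqP db.
have -> : b i0 = - ((d i0)^-1 *: \sum_(j < m) d (lift i0 j) *: b (lift i0 j)).
  by rewrite -scalerN -db scalerA mulVf ?scale1r.
rewrite scalerN scalerA addrC scaler_sumr -sumrB; apply: eq_bigr => j _.
by rewrite scalerA scalerBl.
Qed.

(** If [r *: x] is in the span, then [k (x) x] equals [(k / r) (x) (r *: x)]; so the [1 (x) c i]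
    span, and a minimal spanning family is a basis. *)
Lemma span_finite_rank (R : idomainType) (C : lmodType R) n (c : nat -> C) :
  purification (lspan n c) = setT -> finite_rank C.
Proof.
move=> cT; set phi := (@tofrac R : {rmorphism R -> {fraction R}}).
pose b (i : 'I_n) := tens phi (1 : {fraction R}^o) (c i).
apply: (@minimal_spanning_unique _ _ n b).
have b0 : exists k : 'I_n -> {fraction R}, 0 = \sum_i k i *: b i.
  by exists (fun=> 0); rewrite big1 // => i _; rewrite scale0r.
have bD v w : (exists k : 'I_n -> {fraction R}, v = \sum_i k i *: b i) ->
    (exists k : 'I_n -> {fraction R}, w = \sum_i k i *: b i) ->
    exists k : 'I_n -> {fraction R}, v + w = \sum_i k i *: b i.
  move=> [k ->] [l ->]; exists (fun i => k i + l i).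
  by under [RHS]eq_bigr do rewrite scalerDl; rewrite big_split.
elim/(@tensorW R _ phi) => s; rewrite tensor_piE.
apply: (big_ind (fun v => exists k : 'I_n -> {fraction R},
  v = \sum_i k i *: b i)) => //.
move=> [k x] _ /=.
have [r r0 [a rx]] : purification (lspan n c) x by rewrite cT.
have r0' : tofrac r != 0 by rewrite tofrac_eq0.
exists (fun i => k / tofrac r * tofrac (a i)).
have -> : tens phi k x = (k / tofrac r) *: tens phi 1 (r *: x).
  rewrite tensZr -!tensZl; congr tens.
  by rewrite /GRing.scale /= mulr1 mulfVK.
rewrite rx.
have -> : tens phi 1 (\sum_(i < n) a i *: c i)
    = \sum_(i < n) tofrac (a i) *: b i.
  apply: (big_rec2 (fun x v => tens phi 1 x = v)) => [|i x' v _ <-].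
    by rewrite -(scale0r 0) tensZr rmorph0 scale0r.
  by rewrite tensDr tensZr.
by rewrite scaler_sumr; apply: eq_bigr => i _; rewrite scalerA.
Qed.

(** * Enumerations of countable types *)

Lemma countable_enum (T : Type) (x0 : T) : countable [set: T] ->
  exists e : nat -> T, forall x, exists n, e n = x.
Proof.
move=> /countable_injP[f fI].
have /choice[e eP] : forall n, exists x, (exists y, f y = n) -> f x = n.
  move=> n; have [[y yn]|nn] := pselect (exists y, f y = n); first by exists y.
  by exists x0.
exists e => x; exists (f x); apply: fI; rewrite ?inE //.
by apply: eP; exists x.
Qed.

Lemma countable_enum_seq (T : Type) (x0 : T) : countable [set: T] ->
  exists e : nat -> seq T, forall s, exists n, e n = s.
Proof.
move=> /(countable_enum x0)[e eP].
exists (fun n => map e (odflt [::] (unpickle n))) => s.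
have [t <-] : exists t, map e t = s.
  elim: s => [|x s [t <-]]; first by exists [::].
  by have [n <-] := eP x; exists (n :: t).
by exists (pickle t); rewrite pickleK.
Qed.

(** * From finite rank to length at most one *)

Section FiniteRank.
Variables (R : idomainType) (C A : lmodType R).
Variable r : countable_projective_resolution C.
Local Notation S := (res_S r).
Local Notation P := (res_P r).
Hypothesis A_torsion_free : forall (q : R) (x : A),
  q != 0 -> q *: x = 0 -> x = 0.
Variables (n : nat) (p : nat -> P).
Hypothesis p_span : purification (lspan n (res_p r \o p)) = setT.

(* [q = 0] is allowed: this forces [f] and [a] to respect the relations
   between [S] and the [p j]. *)
Definition extends_with (a : seq A) : set (homSpace S A) :=
  [set f | forall (q : R) (x : P) (s : S) (b : nat -> R),
    q *: x = res_i r s + \sum_(j < n) b j *: p j ->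
    exists y, q *: y = (f : {linear S -> A}) s + \sum_(j < n) b j *: a`_j].

(** Each of the defining conditions involves only one value [f s]. *)
Lemma closed_extends_with a : closed (extends_with a).
Proof.
apply/closed_homSpaceP => f fF q x s b qx.
have [g [gF fg]] := fF [:: s].
by rewrite fg ?mem_head //; exact: gF qx.
Qed.

Lemma ext_null_extends_with : @ext_null R C A r = \bigcup_a extends_with a.
Proof.
have combB (V : lmodType R) (c d : R) (u v : nat -> R) (w : nat -> V) :
    c *: (\sum_(j < n) u j *: w j) + d *: (\sum_(j < n) v j *: w j)
      = \sum_(j < n) (c * u j + d * v j) *: w j.
  rewrite !scaler_sumr -big_split; apply: eq_bigr => j _ /=.
  by rewrite !scalerA scalerDl.
apply/seteqP; split=> [_ [g _ <-]|f [a _ fa]].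
  pose h : {linear P -> A} := g; exists (mkseq (h \o p) n) => // q x s b qx.
  exists (h x); rewrite -linearZ_LR qx linearD linear_sum; congr (_ + _).
  by apply: eq_bigr => j _; rewrite linearZ_LR nth_mkseq.
pose fl : {linear S -> A} := f.
pose rel (x : P) (q : R) (s : S) (b : nat -> R) :=
  q *: x = res_i r s + \sum_(j < n) b j *: p j.
pose val (s : S) (b : nat -> R) := fl s + \sum_(j < n) b j *: a`_j.
have relP x : exists q s b, q != 0 /\ rel x q s b.
  have [q q0 [b qx]] : purification (lspan n (res_p r \o p)) (res_p r x).
    by rewrite p_span.
  have [s _ sE] : range (res_i r) (q *: x - \sum_(j < n) b j *: p j).
    rewrite (res_exact r) /= linearB linearZ_LR qx linear_sum; apply/eqP.
    by rewrite subr_eq0; apply/eqP/eq_bigr => j _; rewrite linearZ_LR.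
  by exists q, s, b; rewrite /rel sE subrK.
(* This is the case [q = 0] of [extends_with]; it makes the extension independent of the relation
   chosen for [x]. *)
have val0 s b : rel 0 0 s b -> val s b = 0.
  by move=> /fa[y]; rewrite scale0r => e; exact: esym e.
have rel_comb x x' q q' s s' b b' c d : rel x q s b -> rel x' q' s' b' ->
    c *: (q *: x) + d *: (q' *: x')
      = res_i r (c *: s + d *: s') + \sum_(j < n) (c * b j + d * b' j) *: p j.
  by move=> -> ->; rewrite [res_i r (_ + _)]linearD !linearZ_LR -combB
    !scalerDr addrACA.
have val_comb s s' b b' c d :
    c *: val s b + d *: val s' b' = val (c *: s + d *: s') (fun j =>
      c * b j + d * b' j).
  by rewrite /val [fl (_ + _)]linearD !linearZ_LR -combB !scalerDr addrACA.
(* The value at [x] solves [q *: y = val s b] for one relation with [q != 0]. Cross-multiplying with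
   any other relation of [x] gives a relation of 0, and [A] is torsion free. *)
have /choice[g gP] : forall x, exists y, forall q s b,
  rel x q s b -> q *: y = val s b.
  move=> x; have [q [s [b [q0 xqsb]]]] := relP x;
    have [y qy] := fa _ _ _ _ xqsb.
  exists y => q' s' b' xqsb'.
  apply/eqP; rewrite -subr_eq0; apply/eqP/(A_torsion_free q0).
  rewrite scalerBr scalerA mulrC -scalerA qy -/(val s b).
  rewrite -[- _]scaleNr val_comb; apply: val0; rewrite /rel scale0r.
  by rewrite -(rel_comb _ _ _ _ _ _ _ _ q' (- q) xqsb xqsb') !scalerA mulNr
    mulrC scaleNr subrr.
have gl : linear g.
  move=> c x x'; have [q [s [b [q0 xR]]]] := relP x.
  have [q' [s' [b' [q0' xR']]]] := relP x'.
  apply/eqP; rewrite -subr_eq0; apply/eqP/(A_torsion_free (mulf_neq0 q0 q0')).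
  have combE (V : lmodType R) (u v : V) :
      (q * q') *: (c *: u + v) = (q' * c) *: (q *: u) + q *: (q' *: v).
    by rewrite scalerDr !scalerA; congr (_ *: _ + _); ring.
  have /gP gE : rel (c *: x + x') (q * q') ((q' * c) *: s + q *: s')
      (fun j => q' * c * b j + q * b' j).
    by rewrite /rel combE; exact: rel_comb xR xR'.
  apply/eqP; rewrite scalerBr subr_eq0; apply/eqP.
  by rewrite combE gE (gP _ _ _ _ xR) (gP _ _ _ _ xR') val_comb.
have [h hE] := linear_of_fun gl.
exists (h : homSpace P A) => //; apply: linear_eqP => s /=; rewrite hE.
have : rel (res_i r s) 1 s (fun=> 0).
  by rewrite /rel scale1r big1 ?addr0 // => j _; rewrite scale0r.
move=> /gP; rewrite scale1r => ->; rewrite /val big1 ?addr0 // => j _.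
by rewrite scale0r.
Qed.

End FiniteRank.

Theorem finite_rank_projective_length (R : idomainType) (C : lmodType R) :
  finite_rank C -> plain_projective_length_le1 C.
Proof.
move=> /finite_rank_span[n [c cT]] A A_countable A_flat r.
have /choice[p pP] : forall j, exists x, res_p r x = c j.
  by move=> j; have [x _] : range (res_p r) (c j) by [rewrite res_p_surj];
    exists x.
have pT : purification (lspan n (res_p r \o p)) = setT.
  by rewrite (_ : _ \o _ = c) //; exact/funext.
have [e eP] := countable_enum_seq (0 : A) A_countable.
have NE f : @ext_null R C A r f <-> (\bigcup_a extends_with n p a) f.
  by rewrite (ext_null_extends_with (flat_torsion_free A_flat) pT).
exists (fun k => set_val @^-1` extends_with n p (e k)) => [k|].
  apply: closed_comp => [x _|]; last exact: closed_extends_with.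
  exact: initial_continuous.
apply/seteqP; split=> x.
  move=> /NE[a _ xa]; have [k kE] := eP a.
  by exists k => //=; rewrite kE.
by move=> [k _ xk]; apply/NE; exists (e k).
Qed.

(** * The direct sum of a chain of spans and its telescope *)

Lemma sum_ord_stable (V : nmodType) (F : nat -> V) N M : (N <= M)%N ->
  (forall n, (N <= n)%N -> F n = 0) -> \sum_(n < M) F n = \sum_(n < N) F n.
Proof.
move=> leNM F0; rewrite -!(big_mkord xpredT F) (big_cat_nat (leq0n N) leNM) /=.
rewrite [X in _ + X]big_nat_cond [X in _ + X]big1 ?addr0 // => n.
by rewrite andbT => /andP[Nn _]; exact: F0.
Qed.

Section DirectSum.
Context {R : idomainType} {C : lmodType R} (c : nat -> C).

(** The external direct sum of the [lspan n c], realized by sequences in [C] of finite support. *)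
Definition dsum_pred : {pred nat -> C} := fun d =>
  `[< (forall n, lspan n c (d n)) /\
      exists N, forall n, (N <= n)%N -> d n = 0 >].

Lemma dsum_submod_closed : submod_closed dsum_pred.
Proof.
split.
  apply/asboolP; split=> [n|]; last by exists 0%N.
  exact: submodule0 (lspan_submodule n c).
move=> r x y /asboolP[xc [N xN]] /asboolP[yc [M yM]]; apply/asboolP;
  split=> [n|].
  exact: (lspan_submodule n c).2.
exists (maxn N M) => n; rewrite geq_max => /andP[Nn Mn].
by change (r *: x n + y n = 0); rewrite xN // yM // scaler0 addr0.
Qed.

HB.instance Definition _ :=
  GRing.isSubmodClosed.Build R (nat -> C) dsum_pred dsum_submod_closed.

Record dsum := DSum { dsum_val : nat -> C; _ : dsum_val \in dsum_pred }.

HB.instance Definition _ := [isSub for dsum_val].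
HB.instance Definition _ := [Choice of dsum by <:].
HB.instance Definition _ := [SubChoice_isSubLmodule of dsum by <:].

Implicit Types (d : dsum) (x : C).

Lemma dsum_val_lspan d n : lspan n c (dsum_val d n).
Proof. by case: d => d /= /asboolP[]. Qed.

Lemma dsum_val_bound d : exists N, forall n, (N <= n)%N -> dsum_val d n = 0.
Proof. by case: d => d /= /asboolP[]. Qed.

Lemma dsum_valP (r : R) d d' n :
  dsum_val (r *: d + d') n = r *: dsum_val d n + dsum_val d' n.
Proof. by []. Qed.

Lemma dsum_valB d d' n : dsum_val (d - d') n = dsum_val d n - dsum_val d' n.
Proof. by rewrite [d - d']addrC -[- d']scaleN1r dsum_valP scaleN1r addrC. Qed.

Lemma dsum_eqP d d' : dsum_val d =1 dsum_val d' -> d = d'.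
Proof. by move=> dd'; apply/val_inj/funext. Qed.

Lemma dsum_exists (u : nat -> C) : (forall n, lspan n c (u n)) ->
  (exists N, forall n, (N <= n)%N -> u n = 0) -> exists d, dsum_val d = u.
Proof.
by move=> uc uN; have uP : u \in dsum_pred by [exact/asboolP]; exists (DSum uP).
Qed.

(** For [x] outside [lspan n c] this is the default 0, so that it is linear on [lspan n c] only. *)
Definition dsum_single n x : dsum := insubd 0 (fun k =>
  if k == n then x else 0).

Lemma dsum_single_val n x k : lspan n c x ->
  dsum_val (dsum_single n x) k = if k == n then x else 0.
Proof.
move=> xn; pose f k := if k == n then x else 0.
suff fP : f \in dsum_pred by exact: (congr1 (@^~ k) (insubdK (0 : dsum) fP)).
apply/asboolP; split=> [m|]; last by exists n.+1 => m lt_nm; rewrite /f gtn_eqF.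
by rewrite /f; case: eqP => [-> //|_]; exact: submodule0 (lspan_submodule m c).
Qed.

Lemma dsum_single_linear n : linear_on (lspan n c) (dsum_single n).
Proof.
move=> r x y xn yn; apply: dsum_eqP => k.
rewrite dsum_valP !dsum_single_val //; last exact: (lspan_submodule n c).2.
by case: eqP => // _; rewrite scaler0 addr0.
Qed.

Lemma dsum_decomp d N : (forall n, (N <= n)%N -> dsum_val d n = 0) ->
  d = \sum_(n < N) dsum_single n (dsum_val d n).
Proof.
move=> dN; apply: dsum_eqP => k.
have sumE (I : Type) (s : seq I) (F : I -> dsum) :
    dsum_val (\sum_(i <- s) F i) k = \sum_(i <- s) dsum_val (F i) k.
  elim: s => [|i s IH].
    by have := dsum_valP (-1) 0 0 k;
      rewrite !big_nil scaler0 addr0 scaleN1r addNr.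
  by rewrite !big_cons -IH -{1}[F i]scale1r dsum_valP scale1r.
rewrite sumE (eq_bigr (fun n : 'I_N => if k == n then dsum_val d n else 0));
  last first.
  by move=> n _; rewrite dsum_single_val //; exact: dsum_val_lspan.
have [ltkN|leNk] := ltnP k N.
  rewrite (bigD1 (Ordinal ltkN)) //= eqxx big1 ?addr0 // => j.
  by rewrite -val_eqE /= eq_sym => /negPf ->.
rewrite dN // big1 // => j _; case: eqP => // kj.
by move: leNk; rewrite kj leqNgt ltn_ord.
Qed.

Lemma dsum_linear_ext (A : lmodType R) (f g : {linear dsum -> A}) :
  (forall n x, lspan n c x -> f (dsum_single n x) = g (dsum_single n x)) ->
  f =1 g.
Proof.
move=> fg d; have [N dN] := dsum_val_bound d.
rewrite (dsum_decomp dN) !linear_sum; apply: eq_bigr => n _.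
by apply: fg; exact: dsum_val_lspan.
Qed.

Lemma dsum_linear (A : lmodType R) (u : nat -> C -> A) :
  (forall n, linear_on (lspan n c) (u n)) ->
  exists f : {linear dsum -> A},
    forall n x, lspan n c x -> f (dsum_single n x) = u n x.
Proof.
move=> ul; have u0 n : u n 0 = 0 by exact:
  (linear_on0 (lspan_submodule n c) (ul n)).
have /choice[b bP] := dsum_val_bound.
pose f d := \sum_(n < b d) u n (dsum_val d n).
have fE d N : (forall n, (N <= n)%N -> dsum_val d n = 0) ->
    f d = \sum_(n < N) u n (dsum_val d n).
  move=> dN.
  have F0 M : (forall n, (M <= n)%N -> dsum_val d n = 0) ->
      forall n, (M <= n)%N -> u n (dsum_val d n) = 0.
    by move=> dM n Mn; rewrite dM.
  rewrite /f -(sum_ord_stable (leq_maxl (b d) N) (F0 _ (bP d))).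
  by rewrite (sum_ord_stable (leq_maxr (b d) N) (F0 _ dN)).
have fl : linear f.
  move=> r d d'; pose N := maxn (b d) (b d').
  have dN n : (N <= n)%N -> dsum_val d n = 0.
    by rewrite geq_max => /andP[/bP].
  have d'N n : (N <= n)%N -> dsum_val d' n = 0.
    by rewrite geq_max => /andP[_ /bP].
  rewrite (fE _ _ dN) (fE _ _ d'N) (fE _ N) => [|n Nn]; last first.
    by rewrite dsum_valP dN ?d'N // scaler0 addr0.
  rewrite scaler_sumr -big_split; apply: eq_bigr => n _.
  by rewrite dsum_valP (ul n) //; exact: dsum_val_lspan.
have [g gE] := linear_of_fun fl; exists g => n x xn; rewrite gE.
rewrite (fE _ n.+1) => [|m ltnm]; last by rewrite dsum_single_val // gtn_eqF.
rewrite big_ord_recr /= dsum_single_val // eqxx big1 ?add0r // => j _.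
by rewrite dsum_single_val // ltn_eqF.
Qed.

Lemma dsum_countable : countable [set: C] -> countable [set: dsum].
Proof.
move=> /(countable_enum_seq (0 : C))[e eP].
have /choice[code codeP] : forall d, exists k, dsum_val d =1 nth 0 (e k).
  move=> d; have [N dN] := dsum_val_bound d;
    have [k kE] := eP (mkseq (dsum_val d) N).
  exists k => n; rewrite kE; have [ltnN|leNn] := ltnP n N;
    first by rewrite nth_mkseq.
  by rewrite nth_default ?size_mkseq // dN.
apply/countable_injP; exists code => d d' _ _ dd'.
by apply: dsum_eqP => n; rewrite !codeP dd'.
Qed.

(** Modulo the zero submodule, which is pure as [C] is torsion free, each summand has a dual basis;
    lifting the images of its vectors lifts the map summand by summand. *)
Lemma dsum_projective : prufer_domain R ->
  (forall (r : R) x, r != 0 -> r *: x = 0 -> x = 0) -> projective dsum.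
Proof.
move=> R_prufer tf X Y g f gT.
have p0 : pure_submodule [set 0 : C].
  split; last by move=> r x r0 /= /(tf _ _ r0).
  by split=> // r x y /= -> ->; rewrite scaler0 addr0.
have /choice[u uP] : forall n, exists u : C -> X, linear_on (lspan n c) u /\
    forall x, lspan n c x -> g (u x) = f (dsum_single n x).
  move=> n; have Xs := lspan_submodule n c.
  have [m [phi [v [phil _ vX phiv]]]] := dual_basis n c R_prufer p0.
  have /choice[y yP] : forall i : 'I_m, exists y, g y = f (dsum_single n (v i)).
    by move=> i; have [y _] : range g (f (dsum_single n (v i))) by [rewrite gT];
      exists y.
  exists (fun x => \sum_i (phi i x : R) *: y i); split=> [r x x' xn x'n|x xn].
    rewrite scaler_sumr -big_split; apply: eq_bigr => i _ /=.
    by rewrite (phil i) // scalerDl scalerA.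
  rewrite linear_sum; have /eqP := phiv x xn; rewrite subr_eq0 => /eqP {2}->.
  rewrite (linear_on_sum Xs (@dsum_single_linear n)) => [|i _].
    rewrite linear_sum; apply: eq_bigr => i _.
    rewrite linearZ_LR yP (linear_onZ Xs (@dsum_single_linear n)) //.
    by rewrite linearZ_LR.
  exact: submoduleZ.
have [h hE] := dsum_linear (fun n => (uP n).1).
exists h; apply: (@dsum_linear_ext _ (g \o h) f) => n x xn /=.
by rewrite hE // (uP n).2.
Qed.

End DirectSum.

Arguments dsum {R C} c.

(** The standard presentation of [C] as a colimit: [p] adds up the components, and [i] is the
    identity minus the inclusion of each summand into the next. *)
Lemma telescope (R : idomainType) (C : lmodType R) (c : nat -> C) :
  (forall x, exists n, lspan n c x) ->
  exists (i : {linear dsum c -> dsum c}) (p : {linear dsum c -> C}),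
    [/\ injective i, range i = p @^-1` [set 0], range p = setT
      & forall n x, lspan n c x ->
        i (dsum_single c n x) = dsum_single c n x - dsum_single c n.+1 x].
Proof.
move=> c_exhausts.
have cS n x : lspan n c x -> lspan n.+1 c x by exact: lspan_le.
pose shift (d : dsum c) n := if n is m.+1 then dsum_val d m else 0.
have ex_i (d : dsum c) : exists d' : dsum c,
  dsum_val d' =1 (fun n => dsum_val d n - shift d n).
  have [N dN] := dsum_val_bound d.
  have [||d' d'E] := @dsum_exists _ _ c (fun n => dsum_val d n - shift d n).
  - move=> n; apply: (submoduleB (lspan_submodule n c));
    first exact: dsum_val_lspan.
    case: n => [|n]; first exact: submodule0 (lspan_submodule 0 c).
    by apply: cS; exact: dsum_val_lspan.
  - exists N.+1 => -[//|n] ltNn /=.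
    by rewrite !dN ?subrr //; exact: ltnW.
  - by exists d' => n; rewrite d'E.
have [i iE] := choice ex_i.
have shiftP (r : R) (x y : dsum c) n :
    shift (r *: x + y) n = r *: shift x n + shift y n.
  by case: n => [|n]; [rewrite /= scaler0 addr0|exact: dsum_valP].
have il : linear i.
  move=> r x y; apply: dsum_eqP => n.
  by rewrite dsum_valP !iE dsum_valP shiftP scalerBr opprD addrACA.
have {il} [i' i'E] := linear_of_fun il.
have [p pE] := @dsum_linear _ _ c C (fun _ x => x) (fun _ _ _ _ _ _ => erefl).
have psum d N : (forall n, (N <= n)%N -> dsum_val d n = 0) ->
    p d = \sum_(n < N) dsum_val d n.
  move=> dN; rewrite {1}(dsum_decomp dN) linear_sum; apply: eq_bigr => n _.
  by rewrite pE //; exact: dsum_val_lspan.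
have i_single n x : lspan n c x ->
    i' (dsum_single c n x) = dsum_single c n x - dsum_single c n.+1 x.
  move=> xn; apply: dsum_eqP => k; rewrite i'E iE dsum_valB.
  congr (_ - _); rewrite (dsum_single_val _ (cS _ _ xn)).
  by case: k => //= k; rewrite dsum_single_val.
exists i', p; split=> //.
- move=> d d' dd'; apply: dsum_eqP;
  have vE n : dsum_val d n - shift d n = dsum_val d' n - shift d' n.
    by rewrite -!iE -!i'E dd'.
  by elim=> [|n IH]; [have := vE 0%N; rewrite /= !subr0|have := vE n.+1;
    rewrite /= IH => /addIr].
- apply/seteqP; split=> [_ [d _ <-]|d /= pd0].
    apply: (@dsum_linear_ext _ _ c C (p \o i') \0) => n x xn /=.
    by rewrite i_single // linearB /= !pE // ?subrr //; exact: cS.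
  have [N dN] := dsum_val_bound d.
  have [||h hE] := @dsum_exists _ _ c (fun n => \sum_(j < n.+1) dsum_val d j).
  (* The preimage of [d] is the sequence of its partial sums, which vanish eventually because the
     total sum is [p d = 0]. *)
  + move=> n; apply: (submodule_sum (lspan_submodule n c)) => j _.
    by apply: (@lspan_le _ _ j) (dsum_val_lspan d j); rewrite -ltnS.
  + by exists N => n Nn; rewrite (@sum_ord_stable _ _ N) ?(leqW Nn) // -psum.
  exists h => //; rewrite i'E; apply: dsum_eqP => n; rewrite iE hE.
  case: n => [|n] /=; first by rewrite big_ord_recr big_ord0 /= add0r subr0.
  by rewrite hE [in X in X - _]big_ord_recr /= addrAC subrr add0r.
- apply/seteqP; split=> // x _; have [n xn] := c_exhausts x.
  by exists (dsum_single c n x); rewrite ?pE.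
Qed.

(** * Baire category in the space of homomorphisms *)

(** A relatively closed subset of the closure of [N] is closed in the whole space. *)
Lemma plain_solecki_length_le1_Fsigma (G : topologicalType) (N : set G) :
  plain_solecki_length_le1 N -> Fsigma N.
Proof.
move=> [B Bcl NB].
have /choice[D DP] : forall k, exists D : set G,
  closed D /\ B k = set_val @^-1` D.
  move=> k; have [W oW WB] := closed_openC (Bcl k).
  exists (~` W); split; first exact: open_closedC.
  by apply: setC_inj; rewrite preimage_setC setCK; exact: esym WB.
exists (fun k => D k `&` solecki0 N) => [k|].
  by apply: closedI; [exact: (DP k).1|exact: closed_closure].
apply/seteqP; split=> f.
  move=> Nf; have cNf : f \in solecki0 N by rewrite inE; exact: subset_closure.
  have : (set_val @^-1` N : set (solecki0 N)) (exist _ f cNf) by [].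
  rewrite NB => -[k _]; rewrite (DP k).2 => Df.
  by exists k => //; split=> //; exact: set_mem cNf.
move=> [k _ [Df cNf]]; have cNf' : f \in solecki0 N by rewrite inE.
suff : (set_val @^-1` N : set (solecki0 N)) (exist _ f cNf') by [].
by rewrite NB; exists k => //; rewrite (DP k).2.
Qed.

(** Linearity of [f j] is asked only when all three points lie in [X j], so that the [X j] may be
    finite sets, as in the Baire argument. *)
Lemma linear_glue (R : comNzRingType) (C A : lmodType R) (X : nat -> set C)
    (f : nat -> C -> A) :
  (forall j, X j `<=` X j.+1) -> (forall x, exists j, X j x) ->
  (forall j x, X j x -> f j.+1 x = f j x) ->
  (forall j (r : R) x y, X j x -> X j y -> X j (r *: x + y) ->
    f j (r *: x + y) = r *: f j x + f j y) ->
  exists g : {linear C -> A}, forall j x, X j x -> g x = f j x.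
Proof.
move=> XS /choice[b Xb] fS fl.
have Xle i j x : (i <= j)%N -> X i x -> X j x.
  by move=> /subnKC <- Xi; elim: (j - i)%N => [|d IH]; rewrite ?addn0 ?addnS //;
    exact: XS.
have fle i j x : (i <= j)%N -> X i x -> f j x = f i x.
  move=> /subnKC <- Xi; elim: (j - i)%N => [|d IH]; first by rewrite addn0.
  by rewrite addnS fS //; apply: Xle Xi; rewrite leq_addr.
pose g x := f (b x) x.
have gE j x : X j x -> g x = f j x.
  by move=> Xj; rewrite /g; have [/fle->|/ltnW/fle->] := leqP (b x) j.
have gl : linear g.
  move=> r x y; pose j := maxn (b (r *: x + y)) (maxn (b x) (b y)).
  have [jz jx jy] : [/\ X j (r *: x + y), X j x & X j y].
    by split; (apply: Xle; last exact: Xb); rewrite /j !leq_max leqnn ?orbT.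
  by rewrite !(gE j) // fl.
have [h hE] := linear_of_fun gl; by exists h => j x Xj; rewrite hE (gE j).
Qed.

(* Baire category in the Polish group [Hom(P, A)]: one of the closed sets
   covering the range contains the image of a coset of a basic open subgroup. *)
Lemma ext_null_closure (R : comNzRingType) (C A : lmodType R)
    (r : countable_projective_resolution C) :
  plain_solecki_length_le1 (@ext_null R C A r) ->
  exists E : seq (res_P r), forall f : {linear res_S r -> A},
    (forall F : seq (res_S r), exists g : {linear res_P r -> A},
      {in E, forall x, g x = 0} /\ {in F, forall s, g (res_i r s) = f s}) ->
    exists g : {linear res_P r -> A}, forall s, g (res_i r s) = f s.
Proof.
move=> /plain_solecki_length_le1_Fsigma[F Fcl NF].
pose restr (g : {linear res_P r -> A}) : homSpace (res_S r) A := ext_restr (g :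
  homSpace _ _).
have restrE g s : (restr g : {linear _ -> _}) s = g (res_i r s) by [].
have [[k [E [g0 g0E]]]|nE] := pselect (exists k (E : seq (res_P r)) (g0 :
  {linear res_P r -> A}),
    forall g : {linear res_P r -> A}, {in E, g0 =1 g} -> F k (restr g)).
  exists E => f fE.
  (* [h] is a limit of restrictions of maps agreeing with [g0] on [E]. So it lies in the closed set
     [F k], hence in the range, and subtracting [g0] extends [f]. *)
  pose h : {linear res_S r -> A} := (g0 \o res_i r) \+ f.
  have : F k h.
    apply/(closed_homSpaceP (F k)).1 => // L; have [g [gE gL]] := fE L.
    pose g1 : {linear res_P r -> A} := g0 \+ g.
    exists (restr g1); split.
      by apply: g0E => x /gE gx; rewrite /g1 /= gx addr0.
    by move=> s sL; rewrite restrE /g1 /h /= gL.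
  move=> Fh; have : @ext_null R C A r h by rewrite NF; exists k.
  move=> [g1 _ g1h];
  pose g2 : {linear res_P r -> A} := (g1 : {linear _ -> _}) \- g0.
  exists g2 => s.
  have := congr1 (fun u : {linear res_S r -> A} => u s) g1h.
  by rewrite /= /g2 /= => ->; rewrite addrC addKr.
(* Otherwise every basic open set contains a map whose restriction avoids [F k]. As [F k] is closed,
   finitely many values ensure this. Freezing them, and the [k]-th point of the module, at step [k]
   yields in the limit a map whose restriction lies in no [F k]. *)
exfalso.
have [e eP] := countable_enum 0 (@res_P_countable _ _ r).
pose T := ({linear res_P r -> A} * seq (res_P r))%type.
have stepP (kt : nat * T) : exists t' : T,
    [/\ {in kt.2.2, t'.1 =1 kt.2.1}, {subset kt.2.2 <= t'.2}, e kt.1 \in t'.2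
      & forall g : {linear res_P r -> A}, {in t'.2, t'.1 =1 g}
        -> ~ F kt.1 (restr g)].
  case: kt => k [g E] /=.
  have [g' [gg' nFg']] : exists g' : {linear res_P r -> A}, {in E,
    g =1 g'} /\ ~ F k (restr g').
    apply: contrapT => ng'; apply: nE; exists k, E, g => g' gg'.
    by apply: contrapT => nF; apply: ng'; exists g'.
  have [L LP] : exists L : seq (res_S r), forall h : {linear res_S r -> A},
      {in L, (restr g' : {linear _ -> _}) =1 h} -> ~ F k h.
    apply: contrapT => nL; apply: nFg';
      apply/(closed_homSpaceP (F k)).1 => // L.
    apply: contrapT => nh; apply: nL; exists L => h hL Fh; apply: nh.
    by exists h.
  exists (g', e k :: E ++ map (res_i r) L); split => /=.
  - by move=> x /gg'.
  - by move=> x xE; rewrite inE mem_cat xE orbT.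
  - exact: mem_head.
  - move=> g'' g''E; apply: LP => s sL; rewrite !restrE; apply: g''E.
    by rewrite inE mem_cat map_f ?orbT.
have [step {}stepP] := choice stepP.
pose fix st k : T := if k is k'.+1 then step (k',
  st k') else ((\0 : {linear _ -> _}), [::]).
have [g gE] : exists g : {linear res_P r -> A}, forall k x,
  x \in (st k).2 -> g x = (st k).1 x.
  apply: (@linear_glue _ _ _ (fun k => [set x | x \in (st k).2]) (fun k =>
    (st k).1)) => /=.
  - by move=> k x; have [_ + _ _] := stepP (k, st k); exact.
  - by move=> x; have [k <-] := eP x; exists k.+1;
    have [_ _ + _] := stepP (k, st k).
  - by move=> k x; have [+ _ _ _] := stepP (k, st k); exact.
  - by move=> k a x y _ _ _; rewrite linearP.
have : @ext_null R C A r (restr g) by exists g.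
rewrite NF => -[k _ Fg]; have [_ _ _ /(_ g)] := stepP (k, st k).
by apply=> // x xE; rewrite (gE k.+1).
Qed.

(** * Finitely generated projective summands *)

(** On the image of [f], the [phi i] and the vectors [f (w i)] form a dual basis. *)
Lemma idempotent_in_Phi (R : comNzRingType) (C : lmodType R)
    (f : {linear C -> C}) n (phi : 'I_n -> {linear C -> R^o}) (w : 'I_n -> C) :
  f \o f =1 f -> (forall x, f x = \sum_i (phi i x : R) *: w i) ->
  range f `<=` Phi C.
Proof.
move=> ff fE x fx.
have bP i : f (w i) \in lrange_pred f by apply/asboolP; exists (w i).
pose b i : lrange f := LRange (bP i).
have valE (v : lrange f) : f (val v) = val v.
  by have /asboolP[y _ <-] := valP v; exact: ff.
have decomp (v : lrange f) : v = \sum_i (phi i (val v) : R) *: b i.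
  apply: val_inj; rewrite raddf_sum /= -[LHS]valE -[X in f X = _]valE [X in f X
    = _]fE linear_sum.
  by apply: eq_bigr => i _; rewrite linearZ_LR.
exists f; split=> //.
  by exists n, b => v; exists (fun i => phi i (val v)).
move=> X Y g h gT.
have /choice[y yP] : forall i, exists y, g y = h (b i).
  by move=> i; have [y _] : range g (h (b i)) by [rewrite gT]; exists y.
have [k kE] : exists k : {linear lrange f -> X},
    k =1 (fun v => \sum_i (phi i (val v) : R) *: y i).
  apply: linear_of_fun => r u v.
  rewrite scaler_sumr -big_split; apply: eq_bigr => i _ /=.
  by rewrite !linearP /= scalerDl scalerA.
exists k => v /=; rewrite kE [in RHS](decomp v) !linear_sum.
by apply: eq_bigr => i _; rewrite !linearZ_LR yP.
Qed.

(** * The tower of dual modules and the Mittag-Leffler condition *)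

Section Tower.
Variables (R : idomainType) (C : lmodType R) (c : nat -> C).
Implicit Types (f g : C -> R^o) (x y : C) (u v : nat -> C -> R^o).
Local Notation X n := (lspan n c).
Local Notation lin n := (@linear_on R C R^o (X n)).

Lemma linear_onB_fun X0 f g : @linear_on R C R^o X0 f ->
  @linear_on R C R^o X0 g -> @linear_on R C R^o X0 (fun x => f x - g x).
Proof.
by move=> fl gl r x y Xx Xy; rewrite fl // gl // scalerBr opprD addrACA.
Qed.

(* In [lim^1] of the tower of the groups [Hom(X n, R)], the classes of the
   families of homomorphisms vanishing on [X m] are trivial. *)
Definition coboundaries_mod m := forall u,
  (forall n, lin n (u n)) -> (forall n x, X m x -> u n x = 0) ->
  exists v, forall n, lin n (v n) /\ forall x,
    X n x -> u n x = v n x - v n.+1 x.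

(** Homomorphisms out of the telescope are families indexed by the stages, and composing with [i]
    turns [v] into the family [v n - v n.+1]. *)
Lemma telescope_coboundaries : prufer_domain R -> countable [set: C] ->
  (forall (r : R) x, r != 0 -> r *: x = 0 -> x = 0) ->
  (forall x, exists n, X n x) ->
  plain_projective_length_rel_le1 C R^o -> exists m, coboundaries_mod m.
Proof.
move=> R_prufer C_countable tf c_exhausts.
have [i [p [i_inj i_exact p_surj i_single]]] := telescope c_exhausts.
have Dc := @dsum_countable R C c C_countable.
have Dp := @dsum_projective R C c R_prufer tf.
pose r := CountableProjectiveResolution Dc Dc Dp Dp i_inj i_exact p_surj.
move=> /(_ r)/ext_null_closure[/= E EP].
have seq_bound (F : seq (dsum c)) : exists M, forall d, d \in F ->
    forall n, (M <= n)%N -> dsum_val d n = 0.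
  elim: F => [|d F [M MF]]; first by exists 0%N.
  have [N dN] := dsum_val_bound d; exists (maxn N M) => d' d'F n.
  rewrite geq_max => /andP[Nn Mn]; move: d'F; rewrite inE => /orP[/eqP ->|/MF];
    first exact: dN.
  exact.
have [m mE] := seq_bound E; exists m => u ul um.
have [f fE] := dsum_linear ul.
have [|g gE] := EP f.
  move=> F; have [M MF] := seq_bound F.
  (* Truncation at [M] gives [w n - w n.+1 = u n] for [n < M], which suffices on [F]. The elements
     of [E] have all their components in [X m], where every [u j] vanishes. *)
  pose w n x : R^o := \sum_(n <= j < M) u j x.
  have wl n : lin n (w n).
    move=> a x y xn yn; rewrite /w scaler_sumr -big_split.
    rewrite big_seq [RHS]big_seq; apply: eq_bigr => j;
      rewrite mem_index_iota => /andP[nj _].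
    by apply: ul; exact: lspan_le nj _ _.
  have [g gE] := dsum_linear wl.
  exists g; split=> d dF.
    rewrite (dsum_decomp (mE d dF)) linear_sum big1 // => n _.
    have dn := dsum_val_lspan d n.
    rewrite gE // /w big1 // => j _; apply: um.
    by apply: lspan_le dn; exact: ltnW.
  rewrite (dsum_decomp (MF d dF)) !linear_sum; apply: eq_bigr => n _.
  have dn := dsum_val_lspan d n.
  have dn1 := lspan_le (leqnSn n) dn.
  by rewrite i_single // linearB /= !gE // fE // /w big_ltn // addrK.
exists (fun n x => g (dsum_single c n x)) => n; split=> [a x y xn yn|x xn].
  by rewrite dsum_single_linear // linearP.
by rewrite -linearB /= -i_single // gE fE.
Qed.

(** The images in the dual of [X k] of the maps vanishing on [X m] stabilize; [f'] vanishes on [X m]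
    as well, since [X m] lies in [X k]. *)
Definition mittag_leffler_mod m := forall k, (m <= k)%N -> exists2 n,
  (k <= n)%N &
  forall n', (n <= n')%N -> forall f, lin n f -> (forall x, X m x -> f x = 0) ->
  exists f', lin n' f' /\ forall x, X k x -> f' x = f x.

(** A linear map on [X k] is determined by its values at the [k] generators. *)
Lemma countable_enum_linear k : countable [set: R] ->
  exists a : nat -> C -> R^o, forall f, lin k f -> exists j, forall x,
    X k x -> a j x = f x.
Proof.
move=> /(countable_enum_seq (0 : R))[e eP].
have /choice[a aP] : forall j, exists f, (exists g,
  lin k g /\ mkseq (g \o c) k = e j) ->
    lin k f /\ mkseq (f \o c) k = e j.
  move=> j; have [[g gP]|ng] := pselect (exists g,
    lin k g /\ mkseq (g \o c) k = e j).
    by exists g.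
  by exists (fun=> 0).
exists a => f fl; have [j jE] := eP (mkseq (f \o c) k); exists j => x xk.
have [|al ae] := aP j; first by exists f; rewrite jE.
have ks := lspan_submodule k c; case: xk => b ->.
have ck i : X k (b i *: c i) \/ (k <= i)%N.
  by have [ki|ik] := leqP k i; [right|left; apply: submoduleZ => //;
    exact: mem_lspan].
rewrite !(linear_on_sum ks) // => [|i _|i _]; try by have [] := ck i;
  rewrite // leqNgt ltn_ord.
apply: eq_bigr => i _; have cik := mem_lspan c (ltn_ord i).
rewrite !(linear_onZ ks) //; congr (_ *: _).
have := congr1 (fun s => nth 0 s i) (etrans ae jE).
by rewrite !nth_mkseq.
Qed.

(* Diagonalization: the [N j] are the stages where the images of the tower
   drop, and a family supported there is built so that the [j]-th of the
   countably many candidates on [X k] does not bound it. *)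
Lemma coboundaries_mittag_leffler m : countable [set: R] ->
  coboundaries_mod m -> mittag_leffler_mod m.
Proof.
move=> R_countable cob k le_mk; apply: contrapT => nML.
have [a aP] := countable_enum_linear k R_countable.
pose ext n f := exists f', lin n f' /\ forall x, X k x -> f' x = f x.
have nextP n : exists nf : nat * (C -> R^o), (k <= n)%N ->
    [/\ (n < nf.1)%N, lin n nf.2, forall x, X m x -> nf.2 x = 0
      & ~ ext nf.1 nf.2].
  have [le_kn|] := boolP (k <= n)%N; last by exists (0%N, fun=> 0).
  apply: contrapT => nn; apply: nML; exists n => // n' le_nn' f fl fm.
  apply: contrapT => next; apply: nn; exists (n', f) => _; split=> //=.
  rewrite ltn_neqAle le_nn' andbT; apply/eqP => nn'; apply: next.
  by exists f; rewrite -nn'.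
have {nextP} [next nextP] := choice nextP.
pose N j := iter j (fun n => (next n).1) k.
have Nk j : (k <= N j)%N.
  elim: j => [|j IH] //=; have [+ _ _ _] := nextP _ IH.
  by move=> /ltnW; exact: leq_trans.
have NS j : (N j < N j.+1)%N by have [] := nextP _ (Nk j).
have N_lt : {homo N : i j / (i < j)%N} by exact: homo_ltn ltn_trans NS.
have N_inj : injective N.
  by move=> i j Nij; case: (ltngtP i j) => // /N_lt; rewrite Nij ltnn.
pose phi j := (next (N j)).2.
(* Since [phi j'] does not extend from [X k] to stage [N j], at most one of [a j' - s j'] and
   [a j' - s j' - phi j'] does. The choice makes [a j' - s j] non-extendable to that stage. *)
pose fix s j : C -> R^o := if j is j'.+1
  then if `[< ext (N j) (fun x => a j' x - s j' x) >] then fun x =>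
    s j' x + phi j' x
    else s j'
  else fun=> 0.
(* [u] is the increment of [s] at the stages [N j] and 0 elsewhere, so that its sum from [k] up to
   [N j] is [s j]. *)
pose u n x : R^o := if pselect (exists j, N j = n) is left h
  then s (projT1 (cid h)).+1 x - s (projT1 (cid h)) x else 0.
have uN j x : u (N j) x = s j.+1 x - s j x.
  rewrite /u; case: pselect => [h|[]]; last by exists j.
  by case: (cid h) => i /= /N_inj ->.
have uN' n x : (forall j, N j <> n) -> u n x = 0.
  by move=> nN; rewrite /u; case: pselect => // -[j jn]; have := nN j jn.
have phiP j := nextP _ (Nk j); rewrite -/(phi _) in phiP.
have s_step j : (forall x, s j.+1 x - s j x = 0) \/ (forall x,
  s j.+1 x - s j x = phi j x).
  by rewrite /=; case: ifP => _; [right|left] => x;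
    rewrite ?addrK ?subrr // addrC addKr.
have u_cases n : (forall x, u n x = 0) \/ exists2 j, N j = n & u n = phi j.
  have [[j jn]|nN] := pselect (exists j, N j = n); last first.
    by left=> x; apply: uN' => j jn; apply: nN; exists j.
  rewrite -jn; have [s0|sphi] := s_step j; first by left=> x; rewrite uN.
  by right; exists j => //; apply/funext => x; rewrite uN.
have [n|n x xm|v vP] := cob u.
- have [u0|[j <- ->]] := u_cases n; last by have [] := phiP j.
  by move=> r x y _ _; rewrite !u0 scaler0 addr0.
- by have [//|[j _ ->]] := u_cases n; have [_ _ + _] := phiP j; exact.
have sum_u j x : \sum_(k <= n < N j) u n x = s j x.
  elim: j => [|j IH]; first by rewrite big_geq.
  rewrite (big_cat_nat (Nk j) (ltnW (NS j))) IH big_ltn //= uN.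
  rewrite big_nat_cond big1 ?addr0; first by rewrite addrC subrK.
  move=> n /andP[/andP[jn nj] _]; apply: uN' => i iN.
  move: jn nj; rewrite -iN; case: (ltngtP i j) => [/N_lt/ltnW|ji|->];
    rewrite ?ltnn //.
    by rewrite leqNgt => /negPf ->.
  move: ji; rewrite leq_eqVlt => /orP[/eqP <-|/N_lt/ltnW];
    first by rewrite ltnn.
  by rewrite leqNgt => /negPf ->.
have sum_v n x : (k <= n)%N -> X k x -> \sum_(k <= j < n) u j x = v k x - v n x.
  move=> le_kn xk; elim: n le_kn => [|n IH].
    by rewrite leqn0 => /eqP ->; rewrite big_geq // subrr.
  rewrite leq_eqVlt => /orP[/eqP <-|le_kn]; first by rewrite big_geq // subrr.
  rewrite big_nat_recr //= IH // (vP n).2; last exact: lspan_le xk.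
  by rewrite addrA subrK.
(* If [v] bounds [u], then [v k] is some [a j] on [X k]; telescoping gives
   [a j - s j.+1 = v (N j.+1)] there, an extension excluded by the choice of [s]. *)
have [j jv] := aP _ (vP k).1.
have ext_s : ext (N j.+1) (fun x => a j x - s j.+1 x).
  exists (v (N j.+1)); split=> [|x xk]; first exact: (vP _).1.
  have := sum_v (N j.+1) x (Nk _) xk; rewrite sum_u => ->.
  by rewrite jv // opprB addrC subrK.
have [_ _ _ +] := phiP j; apply; rewrite -[(next _).1]/(N j.+1).
move: ext_s; rewrite /=; case: asboolP => [[f [fl fE]] [g [gl gE]]|] //.
exists (fun x => f x - g x); split; first exact: linear_onB_fun.
by move=> x xk; rewrite fE // gE // opprB addrC addrA subrK addrC addKr.
Qed.

End Tower.

(** * Extending functionals to [C] and splitting off a summand *)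

Section Splitting.
Variables (R : idomainType) (C : lmodType R) (c : nat -> C).
Local Notation X n := (lspan n c).
Local Notation lin n := (@linear_on R C R^o (X n)).

(** Maps are extended stage after stage; each step preserves the values on the current stage, so the
    results glue. *)
Lemma mittag_leffler_extension m k : (forall x, exists n, X n x) ->
  mittag_leffler_mod c m -> (m <= k)%N ->
  exists2 n, (k <= n)%N & forall f, lin n f -> (forall x, X m x -> f x = 0) ->
  exists g : {linear C -> R^o}, forall x, X k x -> g x = f x.
Proof.
move=> c_exhausts ML le_mk.
have nP j : exists n, (m <= j)%N -> (j <= n)%N /\ forall n', (n <= n')%N ->
    forall f, lin n f -> (forall x, X m x -> f x = 0) ->
    exists f', lin n' f' /\ forall x, X j x -> f' x = f x.
  have [mj|] := boolP (m <= j)%N; last by exists 0%N.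
  by have [n jn nP] := ML j mj; exists n.
have {nP} [nu nuP] := choice nP.
exists (nu k) => [|f0 f0l f0m]; first exact: (nuP k le_mk).1.
pose T := (nat * (C -> R^o))%type.
pose good (t : T) := [/\ (m <= t.1)%N, lin (nu t.1) t.2
  & forall x, X m x -> t.2 x = 0].
have stepP (t : T) : exists t' : T, good t ->
    [/\ good t', (t.1 < t'.1)%N & forall x, X t.1 x -> t'.2 x = t.2 x].
  have [[mj fl fm]|] := pselect (good t); last by exists t.
  case: t => j f /= in mj fl fm *.
  (* Being linear up to [nu j], the map [f] can be changed outside [X j] to become linear up to
     [nu j']. The successor makes the stages increase strictly, so that they exhaust [C]. *)
  have [le_jn nP] := nuP _ mj; pose j' := (nu j).+1.
  have mj' : (m <= j')%N by apply: leq_trans mj _; exact: leqW.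
  have [|f' [f'l f'f]] := nP (nu j') _ f fl fm.
    by apply: leq_trans (nuP _ mj').1; exact: leqnSn.
  exists (j', f') => _; split=> //; split=> //= x xm.
  by rewrite f'f ?fm //; exact: lspan_le xm.
have [step {}stepP] := choice stepP.
pose st j := iter j step (k, f0).
have st_good j : good (st j).
  by elim: j => [|j IH]; [split|have [] := stepP _ IH].
have st_ge j : (j <= (st j).1)%N.
  elim: j => [|j IH] //; have [_ + _] := stepP _ (st_good j).
  exact: leq_ltn_trans.
have st_le j : ((st j).1 <= nu (st j).1)%N.
  by have [mj _ _] := st_good j; exact: (nuP _ mj).1.
have [g gE] : exists g : {linear C -> R^o}, forall j x,
  X (st j).1 x -> g x = (st j).2 x.
  apply: (@linear_glue _ _ _ (fun j => X (st j).1) (fun j => (st j).2)).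
  - by move=> j; have [_ /ltnW + _] := stepP _ (st_good j); exact: lspan_le.
  - by move=> x; have [n xn] := c_exhausts x; exists n;
    exact: lspan_le (st_ge n) _ xn.
  - by move=> j x xj; have [_ _ ->] := stepP _ (st_good j).
  - move=> j r x y xj yj _; have [_ fl _] := st_good j.
    by apply: fl; exact: lspan_le (st_le j) _ _.
by exists g => x xk; rewrite (gE 0%N).
Qed.

(* [e] below is the identity modulo [Y] on the purification [Z] of [X k], and
   [q] retracts [X n] onto its intersection with [Z]; so the square of [q \o e]
   projects [C] onto a copy of [Z / Y]. *)
Lemma coreduced_purification m k n : prufer_domain R ->
  (forall (r : R) (x : C), r != 0 -> r *: x = 0 -> x = 0) -> coreduced C ->
  (m <= k)%N -> (k <= n)%N ->
  (forall f, lin n f -> (forall x, X m x -> f x = 0) ->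
    exists g : {linear C -> R^o}, forall x, X k x -> g x = f x) ->
  X k `<=` purification (X m).
Proof.
move=> R_prufer tf C_coreduced le_mk le_kn fext.
have Xns := lspan_submodule n c.
pose Y := purification (X m); pose Z := purification (X k).
have Yp : pure_submodule Y := purification_pure (lspan_submodule m c).
have Zp : pure_submodule Z := purification_pure (lspan_submodule k c).
have [Ys Ypure] := Yp; have [Zs Zpure] := Zp.
have YZ : Y `<=` Z by move=> x [r r0 rx]; exists r => //; exact: lspan_le rx.
have [l [phi [v [phil phiY vX phiv]]]] := dual_basis n c R_prufer Yp.
have [l' [phi' [v' [phi'l phi'Z v'X phi'v]]]] := dual_basis n c R_prufer Zp.
(* The [phi i] vanish on [X m], so their restrictions to [X k] extend to [C]. *)
have psiP i : exists g : {linear C -> R^o}, forall x, X k x -> g x = phi i x.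
  apply: fext => // x xm; apply: phiY; last exact: sub_purification.
  by apply: lspan_le xm; exact: leq_trans le_kn.
have {psiP} [psi psiE] := choice psiP.
pose e x := \sum_i (psi i x : R) *: v i.
pose q x := x - \sum_i (phi' i x : R) *: v' i.
have eX x : X n (e x) by apply: submodule_sum => // i _; exact: submoduleZ.
have el : linear e.
  move=> r x y; rewrite /e scaler_sumr -big_split; apply: eq_bigr => i _ /=.
  by rewrite linearP /= scalerDl scalerA.
have eZ (r : R) x : e (r *: x) = r *: e x.
  rewrite /e scaler_sumr; apply: eq_bigr => i _.
  by rewrite linearZ_LR scalerA.
have ql : linear_on (X n) q.
  move=> r x y Xx Xy; rewrite /q scalerBr addrACA -opprD; congr (_ - _).
  rewrite scaler_sumr -big_split; apply: eq_bigr => i _ /=.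
  by rewrite (phi'l i) // scalerDl scalerA.
have qZ x : X n x -> Z (q x) by move=> Xx; exact: phi'v.
have q_id x : X n x -> Z x -> q x = x.
  by move=> Xx Zx; rewrite /q big1 ?subr0 // => i _; rewrite phi'Z ?scale0r.
have e_mod x : Z x -> Y (e x - x).
  move=> [r r0 rx]; apply: (Ypure r) => //; rewrite scalerBr -eZ.
  rewrite -opprB -sub0r; apply: submoduleB => //; first exact: submodule0.
  rewrite /e; under eq_bigr => i _ do rewrite (psiE i) //.
  by apply: phiv; exact: lspan_le rx.
have e_Y y : Y y -> e y = 0.
  move=> [r r0 ry]; rewrite /e big1 // => i _.
  suff -> : psi i y = 0 by rewrite scale0r.
  have : r * psi i y = 0.
    rewrite -[_ * _]/(r *: psi i y) -linearZ_LR psiE; last exact: lspan_le ry.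
    apply: phiY; last exact: sub_purification.
    by apply: lspan_le ry; exact: leq_trans le_kn.
  by move=> /eqP; rewrite mulf_eq0 (negPf r0) => /eqP.
have tl : linear (q \o e) by move=> r x y /=; rewrite el ql.
have [t tE] := linear_of_fun tl.
have t_Y y : Y y -> t y = 0.
  by move=> Yy; rewrite tE /= e_Y //; exact: (linear_on0 Xns ql).
have tZ x : Z (t x) by rewrite tE; exact: qZ.
have t_mod x : Z x -> Y (t x - x).
  move=> Zx; rewrite tE /= q_id //; first exact: e_mod.
  rewrite -[e x](subrK x); apply: submoduleD => //; apply: YZ; exact: e_mod.
have ttE x : Z x -> t (t x) = t x.
  move=> Zx; rewrite -{1}[t x](subrK x) linearD [t (_ - _)]t_Y ?add0r //.
  exact: t_mod.
(* [t] maps [C] into [Z], and [t (t x) = t x] is known for [x] in [Z]; this makes the square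
   idempotent on all of [C]. *)
pose f : {linear C -> C} := t \o t.
have ff : f \o f =1 f by move=> x; rewrite /f /= !(ttE _ (tZ x)).
have fE x : f x = \sum_i (psi i x : R) *: t (q (v i)).
  rewrite /f /= [t x]tE /= /e (linear_on_sum Xns ql) => [|i _];
    last exact: submoduleZ.
  rewrite linear_sum; apply: eq_bigr => i _.
  by rewrite (linear_onZ Xns ql) // linearZ_LR.
have f0 x : f x = 0.
  have : Phi C (f x) by apply: (idempotent_in_Phi ff fE); exists x.
  by rewrite C_coreduced.
move=> x xk; have Zx : Z x := sub_purification xk.
(* On [Z] the map [t] equals its square [f], which is 0; so [t x - x] is [- x]. *)
have : Y (t x - x) := t_mod x Zx.
rewrite -(ttE x Zx) -[t (t x)]/(f x) f0 sub0r => YNx.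
by rewrite -[x]opprK -sub0r; apply: submoduleB => //; exact: submodule0.
Qed.

End Splitting.

(** * Finite rank from length at most one, and the equivalence *)

Theorem projective_length_finite_rank (R : idomainType) (C : lmodType R) :
  countable [set: R] -> prufer_domain R -> countable [set: C] -> flat C ->
  coreduced C -> plain_projective_length_rel_le1 C R^o -> finite_rank C.
Proof.
move=> R_countable R_prufer C_countable C_flat C_coreduced length1.
have tf := flat_torsion_free C_flat.
have [c c_surj] := countable_enum 0 C_countable.
have c_exhausts x : exists n, lspan n c x.
  by have [n <-] := c_surj x; exists n.+1; exact: mem_lspan.
have [m cob] := telescope_coboundaries R_prufer C_countable tf c_exhausts
  length1.
have ML := coboundaries_mittag_leffler R_countable cob.
apply: (@span_finite_rank _ _ m c); apply/seteqP; split=> // x _.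
have [j xj] := c_exhausts x; pose k := maxn m j.
have le_mk : (m <= k)%N by exact: leq_maxl.
have [n le_kn next] := mittag_leffler_extension c_exhausts ML le_mk.
apply: (coreduced_purification R_prufer tf C_coreduced le_mk le_kn next).
by apply: lspan_le xj; exact: leq_maxr.
Qed.

Theorem theorem9p38 (R : idomainType) (R_countable : countable [set: R])
    (R_prufer : prufer_domain R) (C : lmodType R)
    (C_countable : countable [set: C]) (C_flat : flat C)
    (C_coreduced : coreduced C) :
  [<-> plain_projective_length_rel_le1 C R^o;
       plain_projective_length_le1 C;
       finite_rank C].
Proof.
have rank := projective_length_finite_rank R_countable R_prufer C_countable
  C_flat C_coreduced.
have regular : plain_projective_length_le1 C ->
    plain_projective_length_rel_le1 C R^o.
  by apply=> //; exact: flat_regular.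
tfae.
- by move=> /rank; exact: finite_rank_projective_length.
- by move=> /regular.
- by move=> /finite_rank_projective_length.
Qed.
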